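(* Let $T$ be a continuous-logic theory and $\phi(x,y)$ a formula. Then the following are equivalent: (i) $\phi$ is NIP (i.e., NIP on every model of $T$); (ii) for every model $M$ of $T$ and every Radon probability measure $\mu$ on $S_{\phi(y)}(M)$, every type $p\in S_{\phi(x)}(M)$ is $\mu$-almost definable, and $\|[S_\phi](M)\|\leq\|M\|$.
   Context: Continuous logic: structures are complete bounded metric spaces with uniformly continuous bounded predicates; formulas are real-valued. $S_{\phi(x)}(M)$ (resp. $S_{\phi(y)}(M)$) is the compact Hausdorff space of complete $\phi$-types over $M$ in $x$ (resp. in $y$), with the weakest topology making all $p\mapsto\phi(p,b)$ (resp. $q\mapsto \phi(a,q)$), $a,b\in M$, continuous; elements of $M$ are identified with realized types, which are dense. $\phi$ is NIP on $M$ if every sequence $\phi(a_n,y)$, $a_n\in M$, viewed as functions on the type space in $y$, has a pointwise convergent subsequence. Given a Radon probability measure $\mu$ on $S_{\phi(y)}(M)$, a $\mu$-measurable $\psi$ is an almost $\phi$-definable relation over $M$ if there are continuous $g_n:S_{\phi(y)}(M)\to\mathbb R$ with $|g_n|\leq$ the bound of $\phi$ and $g_n(b)\to\psi(b)$ for $\mu$-almost all $b$. Such $\psi$ defines $p\in S_{\phi(x)}(M)$ if $\{b:\phi(p,b)=\psi(b)\}$ is measurable of measure 1; then $p$ is $\mu$-almost definable. When every type $p$ is almost definable by some $\psi^p$, write $p\equiv q$ iff $\psi^p=\psi^q$ a.e., $[S_\phi](M)$ for the set of classes, with metric $d([p],[q])=\int|\psi^p-\psi^q|\,d\mu$. $\|M\|$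 denotes the density character of $M$ as a metric space, and $\|[S_\phi](M)\|$ the density character of $[S_\phi](M)$.
   Formalization: A type p over M fixes φ(p,b) only for b in M; for b in S_φ(y)(M), φ(p,b) is read as a limit of φ(a_i,b) along a net a_i→p in M (φ(a,b) if p is realized by a), and (ii) is required for every choice of such limits. *)

(* Defs.v *)
From HB Require Import structures.
From mathcomp Require Import all_boot all_order all_algebra.
From mathcomp Require Import generic_quotient.
From mathcomp Require Import all_classical all_reals all_analysis.

Set Implicit Arguments.
Unset Strict Implicit.
Unset Printing Implicit Defensive.

Import Order.TTheory GRing.Theory Num.Theory.
Import numFieldNormedType.Exports.

Local Open Scope classical_set_scope.
Local Open Scope ring_scope.
Local Open Scope quotient_scope.

(* Complete metric spaces; [Complete] includes a point, so they are nonempty. *)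
#[short(type="completeMetricType")]
HB.structure Definition CompleteMetric (R : realType) :=
  {M of Metric R M & Complete M}.

(* Signatures are single-sorted and of arbitrary cardinality. Each symbol comes
   with an arity and a modulus of uniform continuity (for the maximum metric on
   tuples); predicate symbols also come with a bound, and [diameter] bounds the
   metric. Constants are function symbols of arity 0. *)
Record signature (R : realType) := Signature {
  diameter : R;
  fsym : Type;
  farity : fsym -> nat;
  fmodulus : fsym -> R -> R;
  fmodulus_gt0 : forall f e, 0 < e -> 0 < fmodulus f e;
  psym : Type;
  parity : psym -> nat;
  pbound : psym -> R;
  pmodulus : psym -> R -> R;
  pmodulus_gt0 : forall P e, 0 < e -> 0 < pmodulus P e
}.

Record structure (R : realType) (L : signature R) := Structure {
  carrier :> completeMetricType R;
  diameterP : forall x y : carrier, mdist x y <= diameter L;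
  finterp : forall f : fsym L, ('I_(farity f) -> carrier) -> carrier;
  finterp_modulus : forall (f : fsym L) e (x y : 'I_(farity f) -> carrier),
    0 < e -> (forall i, mdist (x i) (y i) < fmodulus f e) ->
    mdist (finterp x) (finterp y) <= e;
  pinterp : forall P : psym L, ('I_(parity P) -> carrier) -> R;
  pinterp_bound : forall (P : psym L) (x : 'I_(parity P) -> carrier),
    `|pinterp x| <= pbound P;
  pinterp_modulus : forall (P : psym L) e (x y : 'I_(parity P) -> carrier),
    0 < e -> (forall i, mdist (x i) (y i) < pmodulus P e) ->
    `|pinterp x - pinterp y| <= e
}.
Arguments finterp {R L} s f x.
Arguments pinterp {R L} s P x.

Section Formulas.
Variables (R : realType) (L : signature R).

(* Well-scoped de Bruijn syntax: [formula n] has its free variables among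
   [n] variables, and the quantifiers bind variable [0]. *)
Inductive term (n : nat) : Type :=
| Var of 'I_n
| App (f : fsym L) of ('I_(farity f) -> term n).

Inductive formula : nat -> Type :=
| Dist n of term n & term n : formula n
| Pred n (P : psym L) of ('I_(parity P) -> term n) : formula n
| Conn n k (u : 'rV[R]_k -> R) of continuous u & ('I_k -> formula n) : formula n
| Sup n of formula n.+1 : formula n
| Inf n of formula n.+1 : formula n.

Section Eval.
Variable M : structure L.

Fixpoint eval_term n (v : 'I_n -> M) (t : term n) : M :=
  match t with
  | Var i => v i
  | App f ts => finterp M f (fun i => eval_term v (ts i))
  end.

Definition extend_env n (a : M) (v : 'I_n -> M) (i : 'I_n.+1) : M :=
  oapp v a (unlift ord0 i).

Fixpoint eval n (phi : formula n) : ('I_n -> M) -> R :=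
  match phi with
  | Dist _ s t => fun v => mdist (eval_term v s) (eval_term v t)
  | Pred _ P ts => fun v => pinterp M P (fun i => eval_term v (ts i))
  | Conn _ _ u _ phis => fun v => u (\row_i eval (phis i) v)
  | Sup _ psi => fun v => sup (range (fun a => eval psi (extend_env a v)))
  | Inf _ psi => fun v => inf (range (fun a => eval psi (extend_env a v)))
  end.

End Eval.

(* The bound of a formula: |phi| <= bound phi in every structure. *)
Fixpoint bound n (phi : formula n) : R :=
  match phi with
  | Dist _ _ _ => diameter L
  | Pred _ P _ => pbound P
  | Conn _ k u _ phis =>
      sup [set `|u t| | t in
             [set t : 'rV[R]_k | forall i, `|t ord0 i| <= bound (phis i)]]
  | Sup _ psi => bound psi
  | Inf _ psi => bound psi
  end.

(* A sentence [s] stands for the condition [s = 0]. *)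
Definition theory := set (formula 0).

Definition models (M : structure L) (T : theory) : Prop :=
  forall s, T s -> forall v : 'I_0 -> M, eval s v = 0.

Definition elementary (M N : structure L) (h : M -> N) : Prop :=
  forall n (phi : formula n) (v : 'I_n -> M), eval phi (h \o v) = eval phi v.

(* phi(a, b), with x the variable 0 and y the variable 1 *)
Definition value (phi : formula 2) (M : structure L) (a b : M) : R :=
  eval phi (fun i : 'I_2 => if i == ord0 then a else b).

End Formulas.

Arguments eval_term {R L} M {n} v t.
Arguments eval {R L} M {n} phi v.

Section TypeSpaces.
Variables (R : realType) (L : signature R).

(* Complete types over [M], for the values [f N c b] of a formula at a
   realization [c] and parameters [b]: a complete type is given by the values
   [p b], [b] in [M], that it prescribes, and it is realized in some elementary
   extension of [M]. *)
Definition complete_types (f : forall N : structure L, N -> N -> R)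
    (M : structure L) : set {ptws M -> R} :=
  [set p | exists (N : structure L) (h : M -> N) (c : N),
     elementary h /\ forall b, p b = f N c (h b)].

(* [set_type] carries the initial topology of the inclusion in the space of all
   functions on [M] with pointwise convergence, i.e., the weakest topology
   making all the maps p |-> p b, b in M, continuous. *)
Definition type_space f (M : structure L) : Type := set_type (@complete_types f M).

HB.instance Definition _ f (M : structure L) :=
  Topological.copy (type_space f M) (set_type (@complete_types f M)).

Lemma realized_complete_type f (M : structure L) (a : M) :
  @complete_types f M (f M a).
Proof. by exists M, id, a; split. Qed.

Definition realized f (M : structure L) (a : M) : type_space f M :=
  exist _ (f M a : {ptws M -> R}) (mem_set (@realized_complete_type f M a)).

HB.instance Definition _ f (M : structure L) :=
  isPointed.Build (type_space f M) (realized f (point : M)).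

Definition type_value f (M : structure L) (p : type_space f M) (b : M) : R :=
  set_val p b.

(* S_phi(x)(M) and S_phi(y)(M) *)
Definition xtype (phi : formula L 2) (M : structure L) : ptopologicalType :=
  type_space (fun N c b => value phi c b) M.
Definition ytype (phi : formula L 2) (M : structure L) : ptopologicalType :=
  type_space (fun N c a => value phi a c) M.

End TypeSpaces.

Section TypeValues.
Variables (R : realType) (L : signature R) (phi : formula L 2).
Variable M : structure L.

Definition xtp (a : M) : xtype phi M :=
  realized (fun N c b => value phi c b) a.

Definition yvalue (q : ytype phi M) (a : M) : R := type_value q a.

End TypeValues.

Arguments xtp {R L} phi {M} a.

Section NIP.
Variables (R : realType) (L : signature R) (phi : formula L 2).

Definition NIP_on (M : structure L) : Prop :=
  forall a : nat -> M, exists2 h : nat -> nat, increasing_seq h &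
    forall q : ytype phi M, cvgn (fun n => yvalue q (a (h n))).

Definition NIP (T : theory L) : Prop :=
  forall M : structure L, models M T -> NIP_on M.

End NIP.

Definition Borel (S : ptopologicalType) := g_sigma_algebraType (@open S).

Section Measures.
Variables (R : realType) (S : ptopologicalType) (mu : probability (Borel S) R).

Definition is_radon : Prop :=
  forall A : set S, measurable (A : set (Borel S)) ->
    mu A = ereal_sup [set mu K | K in [set K : set S | compact K /\ K `<=` A]].

(* The completion of [mu]: its measurable sets are the mu-measurable sets. *)
Definition completed_type := caratheodory_type (mu^*)%mu.

HB.instance Definition _ := Measurable.on completed_type.

Definition completion : set completed_type -> \bar R :=
  completed_measure_extension (mu := mu).

HB.instance Definition _ := Measure.on completion.

End Measures.

Arguments completion {R S} mu A.

(* The set of classes of a family of functions on S modulo equality mu-almost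
   everywhere, with the L1 distance. *)
Section AlmostEverywhereClasses.
Variables (R : realType) (S : ptopologicalType) (mu : probability (Borel S) R).
Variables (X : choiceType) (psi : X -> S -> R).

Definition ae_equiv (p q : X) : bool :=
  `[< \forall b \ae (completion mu), psi p b = psi q b >].

Lemma ae_equiv_class_of : equiv_class_of ae_equiv.
Proof.
have FF : Filter (almost_everywhere (completion mu)).
  by apply: ae_filter_ringOfSetsType.
split=> [p|p q|q p r].
- by apply/asboolP; exact: filterE.
- by apply/asboolP/asboolP; apply: filterS => b ->.
- move=> /asboolP qp /asboolP pr; apply/asboolP.
  by apply: filterS2 qp pr => b -> ->.
Qed.

Canonical ae_equiv_equiv := EquivRelPack ae_equiv_class_of.

Definition ae_classes := {eq_quot ae_equiv}.

Definition ae_dist (u v : ae_classes) : R :=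
  \int[completion mu]_b `|psi (repr u) b - psi (repr v) b|.

End AlmostEverywhereClasses.

Section AlmostDefinability.
Variables (R : realType) (L : signature R) (phi : formula L 2).
Variable M : structure L.

(* A complete type p in S_phi(x)(M) prescribes phi(p, b) only for b in M, while
   almost definability refers to phi(p, b) for b in S_phi(y)(M). These values
   are obtained as limits of phi(a_i, b) along a net (here: a filter) of elements
   a_i of M converging to p; they may depend on the net. An evaluation is a
   function (p, b) |-> phi(p, b) obtained by fixing such a net for every p,
   the value being phi(a, b) if p is the type of an element a of M. *)
Definition evaluation (ev : xtype phi M -> ytype phi M -> R) : Prop :=
  (forall (a : M) b, ev (xtp phi a) b = yvalue b a) /\
  (forall p, exists F : set_system M,
     [/\ ProperFilter F, xtp phi @ F --> p &
         forall b : ytype phi M, yvalue b a @[a --> F] --> ev p b]).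

Variable mu : probability (Borel (ytype phi M)) R.

Definition almost_definable_relation (psi : ytype phi M -> R) : Prop :=
  measurable_fun [set: completed_type mu] psi /\
  exists g : nat -> ytype phi M -> R,
    [/\ forall n, continuous (g n),
        forall n b, `|g n b| <= bound phi &
        \forall b \ae (completion mu), g ^~ b @ \oo --> psi b].

Variable ev : xtype phi M -> ytype phi M -> R.

Definition defines (psi : ytype phi M -> R) (p : xtype phi M) : Prop :=
  let A : set (completed_type mu) := [set b | ev p b = psi b] in
  measurable A /\ completion mu A = 1%E.

Definition almost_definable (p : xtype phi M) : Prop :=
  exists2 psi, almost_definable_relation psi & defines psi p.

Definition defining_relations (psi : xtype phi M -> ytype phi M -> R) : Prop :=
  forall p, almost_definable_relation (psi p) /\ defines (psi p) p.

(* [S_phi](M), for the choice p |-> psi p of defining relations, and its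
   metric. *)
Definition type_classes (psi : xtype phi M -> ytype phi M -> R) :=
  ae_classes mu psi.
Definition class_dist (psi : xtype phi M -> ytype phi M -> R) :
    type_classes psi -> type_classes psi -> R := @ae_dist R _ mu _ psi.

End AlmostDefinability.

Definition metric_dense {R : realType} {X : Type} (d : X -> X -> R) (D : set X) :=
  forall x e, 0 < e -> exists2 y, D y & d x y < e.

(* The density character of (X, dX) is at most that of (Y, dY): the least
   cardinality of a dense subset of X is at most the cardinality of every dense
   subset of Y. Finite spaces have finite density characters. *)
Definition density_le {R : realType} {X Y : Type}
    (dX : X -> X -> R) (dY : Y -> Y -> R) : Prop :=
  forall D, metric_dense dY D -> exists2 E, metric_dense dX E & (E #<= D)%card.

(* Main.v *)
(** (i) -> (ii). Let elements of [M] converge to [p] along an ultrafilter [U].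
    Dominated convergence along pointwise convergent subsequences shows that the
    functions [phi(a, .)] are Cauchy in L1 along [U], and a sequence among them
    converges, pointwise and in L1, to some [g]. If [phi(p, .)] differed from [g]
    on a set of positive outer measure, then tau-additivity of the Radon measure
    would allow to choose [a_0, a_1, ...] such that all the patterns of large and
    small values of the [phi(a_n, .)] are realized, and no subsequence would
    converge. Since [phi(p, .)] is an L1 limit of functions [phi(a, .)], the
    classes of realized types are dense, which bounds the density character.

    (ii) -> (i). If [phi] is not NIP on [M], an ultrafilter form of Ramsey's
    theorem gives arbitrarily long finite independent families, hence an
    infinite independent sequence [a] in an ultrapower. In a second ultrapower
    the limit type [p] of [a] is not realized, so that [phi(p, b)] may be taken to
    be the limit of [phi(a_i, b)] along a fixed ultrafilter. Some Radon measure
    makes the events [phi(a_i, .) >= be] independent fair coin flips. A compact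
    set of positive measure contains two points at which all but finitely many
    coins differ, so that [phi(p, .) >= be] at one of them and [phi(p, .) <= al]
    at the other: [phi(p, .)] is not almost everywhere equal to a measurable
    function. *)
Require Import Defs.
From HB Require Import structures.
From mathcomp Require Import all_boot all_order all_algebra.
From mathcomp Require Import all_classical all_reals all_analysis.
From mathcomp Require Import measurable_realfun.
From mathcomp Require Import zify ring lra.

Set Implicit Arguments.
Unset Strict Implicit.
Unset Printing Implicit Defensive.

Import Defs.
Import Order.TTheory GRing.Theory Num.Theory.
Import numFieldNormedType.Exports.

Local Open Scope classical_set_scope.
Local Open Scope ring_scope.
Local Open Scope quotient_scope.

(** * Formulas *)

(** Dominated convergence concerns sequences, whereas [phi(p, .)] is a limit along a net and is not
    known to be measurable. Hence the detour through a sequential limit [g], which is measurable,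
    and the comparison of [phi(p, .)] with [g] by outer measure.

    In the converse, an evaluation is forced at a realized type: it equals [phi(a, .)], which is
    continuous and therefore defined by itself. A counterexample must thus live at an unrealized
    type. The first ultrapower yields an infinite independent sequence but gives no control over
    whether its limit type is realized; the second one is there to exclude that.

    The final contradiction is the classical nonmeasurability of a nonprincipal ultrafilter as a
    subset of the Cantor space: flipping all coordinates but finitely many exchanges the ultrafilter
    with its complement, yet any compact set of positive measure contains such a flipped pair. *)

Lemma ultra_setC (T : Type) (U : set_system T) (A : set T) :
  UltraFilter U -> ~ U A -> U (~` A).
Proof. by move=> UU nUA; case: (in_ultra_setVsetC A UU). Qed.

Lemma ultra_cvg_compact (T : Type) (S : topologicalType) (U : set_system T)
    (f : T -> S) (K : set S) :
  UltraFilter U -> compact K -> U (f @^-1` K) -> exists2 l, K l & f @ U --> l.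
Proof.
move=> UU cK UK.
have [l [Kl cl]] := cK _ (fmap_proper_filter f (@ultra_proper _ _ UU)) UK.
exists l => // V lV; have [//|UnV] := in_ultra_setVsetC (f @^-1` V) UU.
by have [x []] := cl (~` V) V UnV lV.
Qed.

Lemma ultra_cvg_bounded (R : realType) (T : Type) (U : set_system T)
    (f : T -> R) (c : R) :
  UltraFilter U -> (forall x, `|f x| <= c) ->
  exists2 l, `|l| <= c & f x @[x --> U] --> l.
Proof.
move=> UU fc.
have [||l] := @ultra_cvg_compact _ _ U f `[- c, c]%classic UU.
- exact: segment_compact.
- by apply: filterE => x; rewrite /= in_itv/= -ler_norml.
by rewrite /= in_itv/= -ler_norml => lc fl; exists l.
Qed.

Section FormulaBounds.
Variables (R : realType) (L : signature R).

Lemma compact_box (k : nat) (b : 'I_k -> R) :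
  compact [set t : 'rV[R]_k | forall i, `|t ord0 i| <= b i].
Proof.
have -> : [set t : 'rV[R]_k | forall i, `|t ord0 i| <= b i] =
    [set t : 'rV[R]_k | forall i, `[- b i, b i]%classic (t ord0 i)].
  by apply/seteqP; split => t /= tb i; have := tb i;
    rewrite /= in_itv/= ler_norml.
by apply: (@rV_compact R k (fun i => `[- b i, b i]%classic)) => i;
  exact: segment_compact.
Qed.

(** [sup] is only meaningful on bounded sets; compactness of the box makes the clause of [bound] for
    connectives a genuine upper bound. *)
Lemma conn_le_bound (k : nat) (u : 'rV[R]_k -> R) (b : 'I_k -> R)
    (t : 'rV[R]_k) :
  continuous u -> (forall i, `|t ord0 i| <= b i) ->
  `|u t| <= sup [set `|u t| | t in
                 [set t : 'rV[R]_k | forall i, `|t ord0 i| <= b i]].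
Proof.
move=> cu tb; apply: sup_upper_bound; last by exists t.
split; first by exists `|u t|, t.
have : compact (u @` [set t : 'rV[R]_k | forall i, `|t ord0 i| <= b i]).
  apply: continuous_compact; last exact: compact_box.
  exact: continuous_subspaceT.
move=> /compact_bounded [M [_ /(_ (M + 1))]].
rewrite ltrDl ltr01 => /(_ isT) ub.
by exists (M + 1) => _ [s sb <-]; apply: ub; exists s.
Qed.

Lemma eval_bound (M : structure L) n (phi : formula L n) (v : 'I_n -> M) :
  `|eval M phi v| <= bound phi.
Proof.
elim: phi v => {n} /=.
- by move=> n s t v; rewrite ger0_norm ?mdist_ge0 ?diameterP.
- by move=> n P ts v; exact: pinterp_bound.
- move=> n k u cu phis IH v; apply: conn_le_bound => // i.
  by rewrite mxE.
- move=> n psi IH v.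
  have e0 : range (fun a => eval M psi (extend_env a v)) !=set0.
    by exists (eval M psi (extend_env point v)), point.
  rewrite ler_norml; apply/andP; split; last first.
    apply: ge_sup => // _ [a _ <-].
    by have := IH (extend_env a v); rewrite ler_norml => /andP[].
  have := IH (extend_env point v); rewrite ler_norml => /andP[h _].
  apply: le_trans h _; apply: sup_upper_bound; last by exists point.
  split=> //; exists (bound psi) => _ [a _ <-].
  by have := IH (extend_env a v); rewrite ler_norml => /andP[].
- move=> n psi IH v.
  have e0 : range (fun a => eval M psi (extend_env a v)) !=set0.
    by exists (eval M psi (extend_env point v)), point.
  rewrite ler_norml; apply/andP; split.
    apply: lb_le_inf => // _ [a _ <-].
    by have := IH (extend_env a v); rewrite ler_norml => /andP[].
  have := IH (extend_env point v); rewrite ler_norml => /andP[_ h].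
  apply: le_trans h; apply: ge_inf; last by exists point.
  exists (- bound psi) => _ [a _ <-].
  by have := IH (extend_env a v); rewrite ler_norml => /andP[].
Qed.

Lemma eval_has_sup (M : structure L) n (psi : formula L n.+1) (v : 'I_n -> M) :
  has_sup (range (fun a => eval M psi (extend_env a v))).
Proof.
split; first by exists (eval M psi (extend_env point v)), point.
exists (bound psi) => _ [a _ <-].
by have := eval_bound psi (extend_env a v); rewrite ler_norml => /andP[].
Qed.

Lemma eval_has_inf (M : structure L) n (psi : formula L n.+1) (v : 'I_n -> M) :
  has_inf (range (fun a => eval M psi (extend_env a v))).
Proof.
split; first by exists (eval M psi (extend_env point v)), point.
exists (- bound psi) => _ [a _ <-].
by have := eval_bound psi (extend_env a v); rewrite ler_norml => /andP[].
Qed.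

Lemma extend_env0 (M : structure L) n (a : M) (v : 'I_n -> M) :
  extend_env a v ord0 = a.
Proof. by rewrite /extend_env unlift_none. Qed.

Lemma extend_env_lift (M : structure L) n (a : M) (v : 'I_n -> M) i :
  extend_env a v (lift ord0 i) = v i.
Proof. by rewrite /extend_env liftK. Qed.

(** Renaming is needed twice: to put several instances of [phi] under one quantifier, and to
    exchange the two variables of [phi]. *)
Fixpoint rename_term n m (r : 'I_n -> 'I_m) (t : term L n) : term L m :=
  match t with
  | Var i => Var L (r i)
  | App f ts => App (fun i => rename_term r (ts i))
  end.

Definition lift_renaming n m (r : 'I_n -> 'I_m) (i : 'I_n.+1) : 'I_m.+1 :=
  oapp (fun j => lift ord0 (r j)) ord0 (unlift ord0 i).

Fixpoint rename n (phi : formula L n) : forall m, ('I_n -> 'I_m) -> formula L m :=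
  match phi with
  | Dist _ s t => fun m r => Dist (rename_term r s) (rename_term r t)
  | Pred _ P ts => fun m r => Pred (fun i => rename_term r (ts i))
  | Conn _ _ u cu phis => fun m r => Conn cu (fun i => rename (phis i) r)
  | Sup _ psi => fun m r => Sup (rename psi (lift_renaming r))
  | Inf _ psi => fun m r => Inf (rename psi (lift_renaming r))
  end.

Lemma eval_rename_term (M : structure L) n m (r : 'I_n -> 'I_m) (t : term L n)
    (v : 'I_m -> M) :
  eval_term M v (rename_term r t) = eval_term M (v \o r) t.
Proof. by elim: t => //= f ts IH; congr finterp; apply: funext => i; exact: IH. Qed.

Lemma extend_env_rename (M : structure L) n m (r : 'I_n -> 'I_m) (a : M) v :
  extend_env a v \o lift_renaming r = extend_env a (v \o r).
Proof.
apply: funext => i; rewrite /= /lift_renaming.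
by case: (unliftP ord0 i) => [j ->|->] /=;
  rewrite ?extend_env_lift ?extend_env0.
Qed.

Lemma eval_rename (M : structure L) n (phi : formula L n) m (r : 'I_n -> 'I_m)
    (v : 'I_m -> M) :
  eval M (rename phi r) v = eval M phi (v \o r).
Proof.
elim: phi m r v => {n} /=.
- by move=> n s t m r v; rewrite !eval_rename_term.
- move=> n P ts m r v; congr pinterp; apply: funext => i.
  exact: eval_rename_term.
- by move=> n k u cu phis IH m r v; congr (u _); apply/rowP => i; rewrite !mxE IH.
- move=> n psi IH m r v; congr sup; apply: eq_imagel => a _.
  by rewrite IH extend_env_rename.
- move=> n psi IH m r v; congr inf; apply: eq_imagel => a _.
  by rewrite IH extend_env_rename.
Qed.

End FormulaBounds.

(** * Uniform continuity of terms and formulas *)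

Section UniformContinuity.
Variables (R : realType) (L : signature R).

Lemma compact_unif_cont (k : nat) (u : 'rV[R]_k -> R) (K : set 'rV[R]_k) (e : R) :
  continuous u -> compact K -> 0 < e ->
  \forall d \near 0^'+, forall s t : 'rV[R]_k, K s ->
    (forall i, `|s ord0 i - t ord0 i| < d) -> `|u s - u t| < e.
Proof.
move=> cu /compact_near_coveringP cK e0.
pose P (d : R) (s : 'rV[R]_k) := forall t : 'rV[R]_k,
  (forall i, `|s ord0 i - t ord0 i| < d) -> `|u s - u t| < e.
suff : \forall d \near 0^'+, K `<=` P d.
  by apply: filterS => d Pd s t Ks; exact: Pd.
apply: (cK R (0^'+) P) => x Kx.
have e20 : 0 < e / 2 by rewrite divr_gt0.
have /nbhs_ballP [r /= r0 ur] : nbhs x (u @^-1` ball (u x) (e / 2)).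
  by apply: cu; exact: nbhsx_ballx.
have r20 : 0 < r / 2 by rewrite divr_gt0.
exists (ball x (r / 2), [set d | d < r / 2]).
  by split; [exact: nbhsx_ballx|exact: nbhs_right_lt].
move=> [s d] /= [xs dr] t st.
have us : ball (u x) (e / 2) (u s).
  by apply: ur; apply: le_ball xs; rewrite ler_pdivrMr// ler_peMr ?ltW// ltr1n.
have ut : ball (u x) (e / 2) (u t).
  apply: ur; rewrite [r]splitr; apply: ball_triangle xs _.
  split=> // i j; rewrite ord1 /ball/=.
  exact: lt_trans (st j) dr.
have := ball_triangle (ball_sym us) ut.
by rewrite -splitr.
Qed.

Lemma term_unif_cont n (t : term L n) (e : R) : 0 < e ->
  \forall d \near 0^'+, forall (M : structure L) (v w : 'I_n -> M),
    (forall i, mdist (v i) (w i) < d) ->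
    mdist (eval_term M v t) (eval_term M w t) < e.
Proof.
elim: t e => [i|f ts IH] e e0.
  near=> d => M v w vw /=; apply: lt_trans (vw i) _; near: d.
  exact: nbhs_right_lt.
have e20 : 0 < e / 2 by rewrite divr_gt0.
have FF : Filter (0^'+ : set_system R) by exact: at_right_proper_filter.
have := @filter_forall _ _ _ _ FF
  (fun i => IH i _ (fmodulus_gt0 f e20)).
apply: filterS => d Hd M v w vw /=.
apply: (@le_lt_trans _ _ (e / 2)); last first.
  by rewrite ltr_pdivrMr// ltr_pMr// ltr1n.
by apply: finterp_modulus => // i; exact: Hd.
Unshelve. all: by end_near. Qed.

Lemma extend_env_near (M : structure L) n (a : M) (v w : 'I_n -> M) (d : R) :
  0 < d -> (forall i, mdist (v i) (w i) < d) ->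
  forall i, mdist (extend_env a v i) (extend_env a w i) < d.
Proof.
move=> d0 vw i; case: (unliftP ord0 i) => [j ->|->].
  by rewrite !extend_env_lift.
by rewrite !extend_env0 mdistxx.
Qed.

Lemma dist_sup_le (X : Type) (f g : X -> R) (e : R) :
  has_sup (range f) -> has_sup (range g) -> (forall x, `|f x - g x| <= e) ->
  `|sup (range f) - sup (range g)| <= e.
Proof.
move=> [[y [x0 _ _]] ubf] [_ ubg] fg.
rewrite ler_norml; apply/andP; split.
  rewrite lerBrDr addrC lerBlDr; apply: ge_sup; first by exists (g x0), x0.
  move=> _ [x _ <-]; have := fg x; rewrite ler_norml => /andP[h _].
  have : f x <= sup (range f) by apply: ub_le_sup => //; exists x.
  by lra.
rewrite lerBlDr; apply: ge_sup; first by exists (f x0), x0.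
move=> _ [x _ <-]; have := fg x; rewrite ler_norml => /andP[_ h].
have : g x <= sup (range g) by apply: ub_le_sup => //; exists x.
by lra.
Qed.

Lemma dist_inf_le (X : Type) (f g : X -> R) (e : R) :
  has_inf (range f) -> has_inf (range g) -> (forall x, `|f x - g x| <= e) ->
  `|inf (range f) - inf (range g)| <= e.
Proof.
move=> [[y [x0 _ _]] ubf] [_ ubg] fg.
rewrite ler_norml; apply/andP; split.
  rewrite lerBrDr; apply: lb_le_inf; first by exists (f x0), x0.
  move=> _ [x _ <-]; have := fg x; rewrite ler_norml => /andP[h _].
  have : inf (range g) <= g x by apply: ge_inf => //; exists x.
  by lra.
rewrite lerBlDr -lerBlDl; apply: lb_le_inf; first by exists (g x0), x0.
move=> _ [x _ <-]; have := fg x; rewrite ler_norml => /andP[_ h].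
have : inf (range f) <= f x by apply: ge_inf => //; exists x.
by lra.
Qed.

(** The structure is quantified after [d]: the modulus depends on the formula alone, and so serves
    at once for all the elementary extensions in which types are realized. *)
Lemma eval_unif_cont n (phi : formula L n) (e : R) : 0 < e ->
  \forall d \near 0^'+, forall (M : structure L) (v w : 'I_n -> M),
    (forall i, mdist (v i) (w i) < d) -> `|eval M phi v - eval M phi w| < e.
Proof.
elim: phi e => {n}.
- move=> n s t e e0.
  have e20 : 0 < e / 2 by rewrite divr_gt0.
  apply: filterS (filterI (term_unif_cont s e20) (term_unif_cont t e20)) => d [hs ht] M v w vw /=.
  have {}hs := hs _ _ _ vw; have {}ht := ht _ _ _ vw.
  set a := eval_term M v s in hs *; set b := eval_term M v t in ht *.
  set a' := eval_term M w s in hs *; set b' := eval_term M w t in ht *.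
  have h1 := metric_triangle a a' b; have h2 := metric_triangle a' b' b.
  have h3 := metric_triangle a' a b'; have h4 := metric_triangle a b b'.
  rewrite (metric_sym b' b) in h2; rewrite (metric_sym a' a) in h3.
  by rewrite ltr_norml; apply/andP; split; lra.
- move=> n P ts e e0.
  have e20 : 0 < e / 2 by rewrite divr_gt0.
  have FF : Filter (0^'+ : set_system R) by exact: at_right_proper_filter.
  have := @filter_forall _ _ _ _ FF
    (fun i => term_unif_cont (ts i) (pmodulus_gt0 P e20)).
  apply: filterS => d Hd M v w vw /=.
  apply: (@le_lt_trans _ _ (e / 2)); last first.
    by rewrite ltr_pdivrMr// ltr_pMr// ltr1n.
  by apply: pinterp_modulus => // i; exact: Hd.
- move=> n k u cu phis IH e e0.
  have := compact_unif_cont cu (@compact_box R k (fun i => bound (phis i))) e0.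
  move=> hu.
  have [d0 [d00 hd0]] : exists d0 : R, 0 < d0 /\ forall s t : 'rV[R]_k,
      (forall i, `|s ord0 i| <= bound (phis i)) ->
      (forall i, `|s ord0 i - t ord0 i| < d0) -> `|u s - u t| < e.
    have [d0 [/= h1 h2]] := filter_ex (filterI hu (nbhs_right_gt (0 : R))).
    by exists d0.
  have FF : Filter (0^'+ : set_system R) by exact: at_right_proper_filter.
  have := @filter_forall _ _ _ _ FF (fun i => IH i _ d00).
  apply: filterS => d Hd M v w vw /=; apply: hd0 => i; rewrite !mxE.
    exact: eval_bound.
  exact: Hd.
- move=> n psi IH e e0.
  have e20 : 0 < e / 2 by rewrite divr_gt0.
  apply: filterS (filterI (IH _ e20) (nbhs_right_gt (0 : R))) => d [Hd d0] M v w vw /=.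
  apply: (@le_lt_trans _ _ (e / 2)); last first.
    by rewrite ltr_pdivrMr// ltr_pMr// ltr1n.
  apply: dist_sup_le; [exact: eval_has_sup|exact: eval_has_sup|] => a.
  by apply/ltW/Hd; exact: extend_env_near.
- move=> n psi IH e e0.
  have e20 : 0 < e / 2 by rewrite divr_gt0.
  apply: filterS (filterI (IH _ e20) (nbhs_right_gt (0 : R))) => d [Hd d0] M v w vw /=.
  apply: (@le_lt_trans _ _ (e / 2)); last first.
    by rewrite ltr_pdivrMr// ltr_pMr// ltr1n.
  apply: dist_inf_le; [exact: eval_has_inf|exact: eval_has_inf|] => a.
  by apply/ltW/Hd; exact: extend_env_near.
Qed.

End UniformContinuity.

(** * Approximate realization of types in the model *)

Section Density.
Variables (R : realType) (L : signature R).

Lemma elementary_isometry (M N : structure L) (h : M -> N) (a b : M) :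
  elementary h -> mdist (h a) (h b) = mdist a b.
Proof.
move=> eh.
pose v (i : 'I_2) := if i == ord0 then a else b.
exact: (eh _ (Dist (Var L (ord0 : 'I_2)) (Var L (ord_max : 'I_2))) v).
Qed.

Lemma value_rename (phi : formula L 2) (r : 'I_2 -> 'I_2) (M : structure L) a b :
  (forall i, r i = if i == ord0 then ord_max else ord0) ->
  value (rename phi r) a b = @value R L phi M b a.
Proof.
move=> hr; rewrite /value eval_rename; congr eval; apply: funext => i /=.
rewrite hr; have [->|->] : i = ord0 \/ i = ord_max by case: i => -[|[]]// ?; [left|right]; exact: val_inj.
  by [].
by [].
Qed.

Definition l1_dist k (r t : 'rV[R]_k) : R := \sum_i `|t ord0 i - r ord0 i|.

Lemma l1_dist_continuous k (r : 'rV[R]_k) : continuous (l1_dist r).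
Proof.
move=> t; apply: (@cvg_big R _ _ _ _ add_continuous _ (nbhs t) _ _ _ (nbhs_filter t)) => i _.
apply: cvg_norm; apply: cvgB; last exact: cvg_cst.
exact: coord_continuous.
Qed.

(** The infimum over [x] of the sum of the [|phi(x, b_i) - p(b_i)|] is a formula, the reals [p(b_i)]
    being built into its connective. The realization [c] makes it at most 0 in [N], so by
    elementarity it is below [e] in [M]. *)
Lemma complete_type_approx (phi : formula L 2) (M : structure L)
    (p : M -> R) (k : nat) (b : 'I_k -> M) (e : R) :
  @complete_types R L (fun N c b => value phi c b) M p -> 0 < e ->
  exists a, forall i, `|value phi a (b i) - p (b i)| < e.
Proof.
move=> [N [h [c [eh pc]]]] e0.
pose r : 'rV[R]_k := \row_i p (b i).
(* [x] becomes the quantified variable 0, and [y] the [i]-th parameter. *)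
pose ren (i : 'I_k) (j : 'I_2) : 'I_k.+1 := if j == ord0 then ord0 else lift ord0 i.
pose psi := Conn (@l1_dist_continuous k r) (fun i => rename phi (ren i)).
have evpsi (S : structure L) (s : S) (w : 'I_k -> S) :
    eval S psi (extend_env s w) = \sum_i `|value phi s (w i) - p (b i)|.
  rewrite /= /l1_dist; apply: eq_bigr => i _; rewrite !mxE eval_rename.
  congr (`| _ - _ |); congr eval; apply: funext => j /=.
  by rewrite /ren; case: ifP => _; rewrite ?extend_env0 ?extend_env_lift.
have infN : eval N (Inf psi) (h \o b) <= 0.
  apply: ge_inf; first by have [] := eval_has_inf psi (h \o b).
  exists c => //; rewrite -[LHS]/(eval N psi (extend_env c (h \o b))) evpsi big1// => i _ /=.
  by rewrite -pc subrr normr0.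
have : eval M (Inf psi) b < e by rewrite -eh; apply: le_lt_trans infN e0.
move=> /inf_lt [|_ [a _ <-]]; first by have [] := eval_has_inf psi b.
rewrite -[X in X < e]/(eval M psi (extend_env a b)) evpsi => ae.
exists a => i; apply: le_lt_trans ae.
by rewrite (bigD1 i)//= lerDl sumr_ge0.
Qed.

End Density.

(** * Convergence in the type spaces *)

Section TypeSpaceTopology.
Variables (R : realType) (L : signature R).

Lemma cvg_type_space f (M : structure L) (T : Type) (F : set_system T)
    (g : T -> type_space f M) (p : type_space f M) : Filter F ->
  g @ F --> p <-> forall b, type_value (g t) b @[t --> F] --> type_value p b.
Proof.
move=> FF; split.
  move=> gp b.
  have h1 : (set_val : type_space f M -> {ptws M -> R}) \o g @ F --> set_val p.
    by apply: cvg_comp gp _; exact: (@initial_continuous _ _ (set_val : type_space f M -> {ptws M -> R})).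
  by have /pointwise_cvgP /(_ b) := h1.
move=> gp.
have h1 : (set_val : type_space f M -> {ptws M -> R}) \o g @ F --> set_val p.
  by apply/pointwise_cvgP => b; exact: gp.
move=> A [_ [[B oB <-] Bp] BA].
apply: filterS BA _; apply: h1.
by apply: open_nbhs_nbhs.
Qed.

Lemma type_value_continuous f (M : structure L) (b : M) :
  continuous (fun p : type_space f M => type_value p b).
Proof. by move=> p; apply: (cvg_type_space (F := nbhs p) id p _).1. Qed.

Lemma type_space_hausdorff f (M : structure L) : hausdorff_space (type_space f M).
Proof.
move=> p q pq; apply: val_inj; apply: funext => b.
apply: (@Rhausdorff R) => A B pA qB.
have [r [/= Ar Br]] := pq _ _ (@type_value_continuous f M b p _ pA)
  (@type_value_continuous f M b q _ qB).
by exists (type_value r b).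
Qed.

End TypeSpaceTopology.

(** * Ultrapowers *)

(* [ler_cvg_to] for filters on a bare type *)
Lemma ler_cvg_filter (R : realType) (T : Type) (F : set_system T)
    (f g : T -> R) (l m : R) : ProperFilter F ->
  f x @[x --> F] --> l -> g x @[x --> F] --> m -> (forall x, f x <= g x) ->
  l <= m.
Proof.
move=> FF fl gm fg; rewrite -subr_ge0.
apply: (@cvgr_to_ge _ _ FF _ (g \- f)); first exact: cvgB.
by apply: filterE => x /=; rewrite subr_ge0.
Qed.

Section Ultrapower.
Variables (R : realType) (L : signature R) (M : structure L).
Variables (I : Type) (U : set_system I) (UU : UltraFilter U).

Definition upre : Type := I -> M.
HB.instance Definition _ := gen_eqMixin upre.
HB.instance Definition _ := gen_choiceMixin upre.

Definition upre_dist (x y : upre) : R := lim (mdist (x i) (y i) @[i --> U]).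

Lemma upre_distP (x y : upre) : mdist (x i) (y i) @[i --> U] --> upre_dist x y.
Proof.
have [|l _ h] := @ultra_cvg_bounded R I U (fun i => mdist (x i) (y i)) (diameter L) UU.
  by move=> i; rewrite ger0_norm ?mdist_ge0 ?diameterP.
by apply/cvg_ex; exists l.
Qed.
Arguments upre_distP : clear implicits.

Lemma upre_dist_unique (x y : upre) (l : R) :
  mdist (x i) (y i) @[i --> U] --> l -> upre_dist x y = l.
Proof. exact: cvg_lim. Qed.

Lemma upre_distxx x : upre_dist x x = 0.
Proof.
by apply: upre_dist_unique; under eq_cvg do rewrite mdistxx; exact: cvg_cst.
Qed.

Lemma upre_dist_sym x y : upre_dist x y = upre_dist y x.
Proof.
apply: upre_dist_unique; under eq_cvg do rewrite metric_sym.
exact: upre_distP.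
Qed.

Lemma upre_dist_triangle y x z :
  upre_dist x z <= upre_dist x y + upre_dist y z.
Proof.
apply: ler_cvg_filter (upre_distP x z) (cvgD (upre_distP x y) (upre_distP y z)) _.
by move=> i; exact: metric_triangle.
Qed.

Lemma upre_dist_ge0 x y : 0 <= upre_dist x y.
Proof.
apply: (cvgr_to_ge (upre_distP x y)).
by apply: filterE => i; exact: mdist_ge0.
Qed.

Lemma upre_dist_lt x y e : upre_dist x y < e ->
  \forall i \near U, mdist (x i) (y i) < e.
Proof. by move=> h; exact: (cvgr_lt _ (upre_distP x y)). Qed.

Lemma upre_dist_le x y e : (\forall i \near U, mdist (x i) (y i) <= e) ->
  upre_dist x y <= e.
Proof. by move=> h; exact: (cvgr_to_le (upre_distP x y)). Qed.

Definition upre_equiv (x y : upre) := upre_dist x y == 0.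

Lemma upre_equiv_class_of : equiv_class_of upre_equiv.
Proof.
split=> [x|x y|y x z].
- by rewrite /upre_equiv upre_distxx.
- by rewrite /upre_equiv upre_dist_sym.
rewrite /upre_equiv => /eqP xy /eqP yz; rewrite eq_le upre_dist_ge0 andbT.
by apply: le_trans (upre_dist_triangle y _ _) _; rewrite xy yz addr0.
Qed.

Canonical upre_equiv_equiv := EquivRelPack upre_equiv_class_of.

Definition upower := {eq_quot upre_equiv}.
HB.instance Definition _ := Choice.on upower.
HB.instance Definition _ := EqQuotient.on upower.

Definition ucl (x : upre) : upower := \pi_upower x.

Lemma ucl_eq x y : upre_dist x y = 0 -> ucl x = ucl y.
Proof. by move=> xy; apply/eqmodP; rewrite /= /upre_equiv xy. Qed.

Lemma repr_ucl x : upre_dist (repr (ucl x)) x = 0.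
Proof. have /eqP : repr (ucl x) == x %[mod upower] by rewrite reprK.
by move/eqmodP => /eqP. Qed.

Definition upower_dist (x y : upower) := upre_dist (repr x) (repr y).

Lemma upower_dist_ucl x y : upower_dist (ucl x) (ucl y) = upre_dist x y.
Proof.
rewrite /upower_dist; have hx := repr_ucl x; have hy := repr_ucl y.
set x' := repr _ in hx *; set y' := repr _ in hy *.
have h1 := upre_dist_triangle x x' y'; have h2 := upre_dist_triangle y x y'.
have h3 := upre_dist_triangle x' x y; have h4 := upre_dist_triangle y' x' y.
rewrite (upre_dist_sym y y') in h2; rewrite (upre_dist_sym x x') in h3.
apply/eqP; rewrite eq_le; lra.
Qed.

Lemma upower_distxx x : upower_dist x x = 0.
Proof. exact: upre_distxx. Qed.
Lemma upower_dist_eq x y : upower_dist x y = 0 -> x = y.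
Proof. by move/ucl_eq; rewrite /ucl !reprK. Qed.
Lemma upower_dist_sym x y : upower_dist x y = upower_dist y x.
Proof. exact: upre_dist_sym. Qed.
Lemma upower_dist_triangle y x z :
  upower_dist x z <= upower_dist x y + upower_dist y z.
Proof. exact: upre_dist_triangle. Qed.

HB.instance Definition _ := isMetric.Build R upower
  upower_distxx upower_dist_eq upower_dist_sym upower_dist_triangle.
HB.instance Definition _ := isPointed.Build upower (ucl (fun=> point)).

Lemma mdist_ucl x y : mdist (ucl x) (ucl y) = upre_dist x y.
Proof. exact: upower_dist_ucl. Qed.

(* The limit is taken coordinatewise, stopping at coordinate [i] with the last
   term up to which the sequence [X _ i] satisfies the Cauchy bounds. *)
Lemma upower_limit (X : nat -> upre) (e : nat -> R) :
  (forall n, 0 < e n) -> e @ \oo --> 0 ->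
  (forall n m, (n <= m)%N -> e m <= e n) ->
  (forall n m, upre_dist (X n) (X m) < e n + e m) ->
  exists y, forall n, upre_dist (X n) y <= e n + e n.
Proof.
move=> e0 elim emono Xe.
pose G n i := forall k l, (k <= n)%N -> (l <= n)%N ->
  mdist (X k i) (X l i) < e k + e l.
have GU n : \forall i \near U, G n i.
  have : \forall i \near U, forall k l : 'I_n.+1,
      mdist (X k i) (X l i) < e k + e l.
    apply: filter_forall => k; apply: filter_forall => l.
    exact: upre_dist_lt.
  apply: filterS => i h k l kn ln.
  exact: (h (Ordinal (kn : (k < n.+1)%N)) (Ordinal (ln : (l < n.+1)%N))).
suff : forall i, exists y : M, forall n, G n i -> mdist (X n i) y <= e n + e n.
  move=> /choice[y hy]; exists y => n; apply: upre_dist_le.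
  by apply: filterS (GU n) => i; exact: hy.
(* The case in which completeness of [M] enters. It can occur at a large set of coordinates, for
   instance when [U] is principal. *)
move=> i; have [all_G|] := pselect (forall n, G n i).
  have cX : cvg (X n i @[n --> \oo]).
    apply: cauchy_cvg; apply: cauchy_exP => eps eps0.
    have eps2 : 0 < eps / 2 by rewrite divr_gt0.
    have [N _ hN] := cvgr_lt _ elim _ eps2.
    exists (X N i); exists N => // n /= Nn; rewrite ballEmdist/=.
    apply: lt_le_trans (all_G (maxn N n) _ _ _ _) _; rewrite ?leq_maxl ?leq_maxr//.
    have := hN _ (leqnn N); have := hN _ Nn; rewrite /=; lra.
  move/cvg_ex : cX => [y Xy]; exists y => n _.
  apply/ler_addgt0Pr => d d0; have d2 : 0 < d / 2 by rewrite divr_gt0.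
  have h1 : \forall m \near \oo, ball y (d / 2) (X m i).
    by apply: Xy; exact: nbhsx_ballx.
  have [m [h3 /= h4]] := filter_ex (filterI h1 (cvgr_lt _ elim _ d2)).
  rewrite ballEmdist/= metric_sym in h3.
  have := metric_triangle (X n i) (X m i) y.
  have : mdist (X n i) (X m i) < e n + e m.
    by apply: (all_G (maxn n m)); rewrite ?leq_maxl ?leq_maxr.
  by have := e0 n; lra.
move=> /existsNP nG.
have [N nGN minN] : exists2 N, ~ G N i & forall k, ~ G k i -> (N <= k)%N.
  have nG' : exists n, `[< ~ G n i >] by have [n ?] := nG; exists n; apply/asboolP.
  case: (ex_minnP nG') => N /asboolP h1 h2; exists N => // k /asboolP.
  exact: h2.
case: N nGN minN => [|N] nGN minN.
  case: nGN => k l; rewrite !leqn0 => /eqP -> /eqP ->.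
  by rewrite mdistxx addr_gt0.
have GN : G N i by apply: contrapT => /minN; rewrite ltnn.
exists (X N i) => n Gn.
have nN : (n <= N)%N.
  rewrite leqNgt; apply/negP => Nn; apply: nGN => k l kN lN.
  by apply: Gn; [exact: leq_trans kN _|exact: leq_trans lN _].
have := emono _ _ nN; have := GN _ _ nN (leqnn N); lra.
Qed.

Lemma upower_complete (F : set_system upower) :
  ProperFilter F -> cauchy F -> cvg F.
Proof.
move=> FF cF.
pose e n : R := (2^-1) ^+ n.
have e0 n : 0 < e n by rewrite exprn_gt0// invr_gt0.
have elim : e @ \oo --> 0.
  by apply: cvg_expr; rewrite ger0_norm ?invr_ge0// invf_lt1// ltr1n.
have emono n m : (n <= m)%N -> e m <= e n.
  by move=> nm; rewrite /e ler_wiXn2l// ?invr_ge0// invf_le1// ler1n.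
have /choice[x Fx] n : exists x : upower, F (ball x (e n)).
  have /cauchyP h := cF; exact: h.
have xe n m : upre_dist (repr (x n)) (repr (x m)) < e n + e m.
  have [y []] := filter_ex (filterI (Fx n) (Fx m)).
  rewrite !ballEmdist/= => ny my.
  apply: le_lt_trans (@upower_dist_triangle y _ _) _; apply: ltrD => //.
  by rewrite upower_dist_sym.
have [y hy] := upower_limit e0 elim emono xe.
apply/cvg_ex; exists (ucl y) => A /nbhs_ballP[d /= d0 dA].
have d3 : 0 < d / 3 by rewrite divr_gt0.
have [n /= en] := filter_ex (cvgr_lt _ elim _ d3).
apply: filterS (Fx n) => z xz; apply: dA.
rewrite !ballEmdist/= in xz *; rewrite metric_sym in xz.
rewrite metric_sym; apply: le_lt_trans (metric_triangle _ (x n) _) _.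
have : mdist (x n) (ucl y) <= e n + e n.
  by rewrite -[x n]reprK mdist_ucl.
by lra.
Qed.

HB.instance Definition _ := Uniform_isComplete.Build upower upower_complete.

(** Symbols act on chosen representatives; the moduli of uniform continuity make the choice
    irrelevant up to any [e], as [eval_term_ultrapower] and [los] exploit. *)
Definition upower_fun (f : fsym L) (x : 'I_(farity f) -> upower) : upower :=
  ucl (fun i => finterp M f (fun j => repr (x j) i)).

Definition upower_pred (P : psym L) (x : 'I_(parity P) -> upower) : R :=
  lim (pinterp M P (fun j => repr (x j) i) @[i --> U]).

Lemma upower_predP (P : psym L) (x : 'I_(parity P) -> upower) :
  pinterp M P (fun j => repr (x j) i) @[i --> U] --> upower_pred x.
Proof.
have [|l _ h] := @ultra_cvg_bounded R I U
    (fun i => pinterp M P (fun j => repr (x j) i)) (pbound P) UU.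
  by move=> i; exact: pinterp_bound.
by apply/cvg_ex; exists l.
Qed.
Arguments upower_predP : clear implicits.

Lemma upower_diameterP (x y : upower) : mdist x y <= diameter L.
Proof.
by apply: upre_dist_le; apply: filterE => i; exact: diameterP.
Qed.

Lemma upower_fun_modulus (f : fsym L) e (x y : 'I_(farity f) -> upower) :
  0 < e -> (forall i, mdist (x i) (y i) < fmodulus f e) ->
  mdist (upower_fun x) (upower_fun y) <= e.
Proof.
move=> e0 xy; rewrite mdist_ucl; apply: upre_dist_le.
have : \forall i \near U, forall j, mdist (repr (x j) i) (repr (y j) i) < fmodulus f e.
  by apply: filter_forall => j; apply: upre_dist_lt; exact: xy.
by apply: filterS => i h; exact: finterp_modulus.
Qed.

Lemma upower_pred_bound (P : psym L) (x : 'I_(parity P) -> upower) :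
  `|upower_pred x| <= pbound P.
Proof.
apply: (cvgr_to_le (cvg_norm (upower_predP _ x))).
by apply: filterE => i; exact: pinterp_bound.
Qed.

Lemma upower_pred_modulus (P : psym L) e (x y : 'I_(parity P) -> upower) :
  0 < e -> (forall i, mdist (x i) (y i) < pmodulus P e) ->
  `|upower_pred x - upower_pred y| <= e.
Proof.
move=> e0 xy.
apply: (cvgr_to_le (cvg_norm (cvgB (upower_predP _ x) (upower_predP _ y)))).
have : \forall i \near U, forall j, mdist (repr (x j) i) (repr (y j) i) < pmodulus P e.
  by apply: filter_forall => j; apply: upre_dist_lt; exact: xy.
by apply: filterS => i h; exact: pinterp_modulus.
Qed.

Definition ultrapower : structure L :=
  @Structure R L upower upower_diameterP upower_fun upower_fun_modulus
    upower_pred upower_pred_bound upower_pred_modulus.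

Definition ucls n (v : 'I_n -> upre) : 'I_n -> ultrapower := fun j => ucl (v j).
Definition upoint n (v : 'I_n -> upre) (i : I) : 'I_n -> M := fun j => v j i.

Lemma near_repr k (w : 'I_k -> upre) (d : R) : 0 < d ->
  \forall i \near U, forall j, mdist (repr (ucl (w j)) i) (w j i) < d.
Proof.
by move=> d0; apply: filter_forall => j; apply: upre_dist_lt; rewrite repr_ucl.
Qed.

Lemma eval_term_ultrapower n (v : 'I_n -> upre) (t : term L n) :
  eval_term ultrapower (ucls v) t = ucl (fun i => eval_term M (upoint v i) t).
Proof.
elim: t => //= f ts IH; apply: ucl_eq; apply/eqP.
rewrite eq_le upre_dist_ge0 andbT; apply/ler_addgt0Pr => e e0; rewrite add0r.
apply: upre_dist_le.
apply: filterS (near_repr (fun j i => eval_term M (upoint v i) (ts j))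
  (fmodulus_gt0 f e0)) => i h.
by apply: finterp_modulus => // j; rewrite IH.
Qed.

Lemma extend_ucls n (a : upre) (v : 'I_n -> upre) :
  extend_env (ucl a : ultrapower) (ucls v) =
  ucls (fun j => oapp v a (unlift ord0 j)).
Proof.
by apply: funext => j; rewrite /extend_env /ucls; case: unlift.
Qed.

Lemma extend_upoint n (a : upre) (v : 'I_n -> upre) i :
  upoint (fun j => oapp v a (unlift ord0 j)) i = extend_env (a i) (upoint v i).
Proof.
by apply: funext => j; rewrite /extend_env /upoint; case: unlift.
Qed.

(** For a supremum, one inequality is tested on a representative of each element of the ultrapower.
    For the other, almost maximizers chosen coordinatewise form an element whose value is within [e]
    of the limit of the suprema. Infima are dual. *)
Lemma los n (phi : formula L n) (v : 'I_n -> upre) :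
  eval M phi (upoint v i) @[i --> U] --> eval ultrapower phi (ucls v).
Proof.
elim: phi v => {n}.
- move=> n s t v /=; rewrite !eval_term_ultrapower mdist_ucl.
  exact: upre_distP.
- move=> n P ts v /=.
  apply/cvgrPdist_le => e e0.
  have e2 : 0 < e / 2 by rewrite divr_gt0.
  apply: filterS (filterI ((cvgrPdist_le _ _).1 (upower_predP _
    (fun j => eval_term ultrapower (ucls v) (ts j))) _ e2)
    (near_repr (fun j i => eval_term M (upoint v i) (ts j))
       (pmodulus_gt0 P e2))) => i [h1 h2].
  rewrite -[eval_term]/(@eval_term R L) in h1 *.
  set a := upower_pred _ in h1 *.
  have h3 : `|pinterp M P (fun j => repr (eval_term ultrapower (ucls v) (ts j)) i) -
             pinterp M P (fun j => eval_term M (upoint v i) (ts j))| <= e / 2.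
    by apply: pinterp_modulus => // j; rewrite eval_term_ultrapower.
  rewrite [e]splitr; apply: le_trans (lerD h1 h3).
  by rewrite -[X in `|X| <= _](subrKA (pinterp M P (fun j =>
    repr (eval_term ultrapower (ucls v) (ts j)) i))) ler_normD.
- move=> n k u cu phis IH v /=.
  apply: (@continuous_cvg _ _ _ U _ (fun i => \row_j eval M (phis j) (upoint v i)) u).
    exact: cu.
  apply/cvg_ballP => e e0.
  have : \forall i \near U, forall j, ball (eval ultrapower (phis j) (ucls v)) e
      (eval M (phis j) (upoint v i)).
    by apply: filter_forall => j; apply: IH; exact: nbhsx_ballx.
  by apply: filterS => i h; split=> // r j; rewrite !mxE.
- move=> n psi IH v /=.
  set g := fun i => sup _.
  have [|l _ gl] := @ultra_cvg_bounded R I U g (bound psi) UU.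
    by move=> i; exact: (eval_bound (Sup psi)).
  suff -> : sup (range (fun a => eval ultrapower psi (extend_env a (ucls v)))) = l by [].
  apply/eqP; rewrite eq_le; apply/andP; split.
    apply: ge_sup; first by exists (eval ultrapower psi (extend_env point (ucls v))), point.
    move=> _ [a _ <-]; rewrite -[a]reprK -/(ucl (repr a)) extend_ucls.
    apply: ler_cvg_filter (IH _) gl _ => i; rewrite extend_upoint.
    apply: ub_le_sup; first by have [] := eval_has_sup psi (upoint v i).
    by exists (repr a i).
  apply/ler_addgt0Pr => e e0.
  have /choice[a ha] i : exists a, g i - e < eval M psi (extend_env a (upoint v i)).
    have [_ [a _ <-] h] := sup_adherent e0 (eval_has_sup psi (upoint v i)).
    by exists a.
  rewrite -lerBlDr.
  apply: (@le_trans _ _ (eval ultrapower psi (extend_env (ucl a : ultrapower) (ucls v)))).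
    rewrite extend_ucls.
    apply: ler_cvg_filter (cvgB gl (cvg_cst e)) (IH _) _ => i /=.
    by rewrite extend_upoint ltW.
  apply: ub_le_sup; last by exists (ucl a).
  by have [] := eval_has_sup psi (ucls v).
- move=> n psi IH v /=.
  set g := fun i => inf _.
  have [|l _ gl] := @ultra_cvg_bounded R I U g (bound psi) UU.
    by move=> i; exact: (eval_bound (Inf psi)).
  suff -> : inf (range (fun a => eval ultrapower psi (extend_env a (ucls v)))) = l by [].
  apply/eqP; rewrite eq_le; apply/andP; split; last first.
    apply: lb_le_inf; first by exists (eval ultrapower psi (extend_env point (ucls v))), point.
    move=> _ [a _ <-]; rewrite -[a]reprK -/(ucl (repr a)) extend_ucls.
    apply: ler_cvg_filter gl (IH _) _ => i; rewrite extend_upoint.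
    apply: ge_inf; first by have [] := eval_has_inf psi (upoint v i).
    by exists (repr a i).
  apply/ler_addgt0Pr => e e0.
  have /choice[a ha] i : exists a, eval M psi (extend_env a (upoint v i)) < g i + e.
    have [_ [a _ <-] h] := inf_adherent e0 (eval_has_inf psi (upoint v i)).
    by exists a.
  apply: (@le_trans _ _ (eval ultrapower psi (extend_env (ucl a : ultrapower) (ucls v)))).
    apply: ge_inf; last by exists (ucl a).
    by have [] := eval_has_inf psi (ucls v).
  rewrite extend_ucls.
  apply: ler_cvg_filter (IH _) (cvgD gl (cvg_cst e)) _ => i /=.
  by rewrite extend_upoint ltW.
Qed.
Arguments los : clear implicits.

Definition diag (a : M) : ultrapower := ucl (fun=> a).

Lemma diag_elementary : elementary diag.
Proof.
move=> n phi v; apply: (cvg_unique (@Rhausdorff R) (los _ phi (fun j _ => v j))); exact: cvg_cst.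
Qed.

Lemma models_ultrapower (T : theory L) : models M T -> models ultrapower T.
Proof.
move=> MT s Ts v.
(* ['I_0] is empty, so [v] equals the diagonal image of an environment in [M], and elementarity
   applies. *)
have -> : v = diag \o (fun j => repr (v j) (projT1 (cid (filter_ex (@filterT _ U _))))).
  by apply: funext => -[].
by rewrite diag_elementary MT.
Qed.

Lemma value_ultrapower (phi : formula L 2) (a b : upre) :
  value phi (a i) (b i) @[i --> U] -->
  value phi (ucl a : ultrapower) (ucl b : ultrapower).
Proof.
have := los _ phi (fun j => if j == ord0 then a else b).
have -> : ucls (fun j : 'I_2 => if j == ord0 then a else b) =
    (fun j => if j == ord0 then ucl a else ucl b).
  by apply: funext => j; rewrite /ucls; case: ifP.
apply: cvg_trans; apply: near_eq_cvg; apply: filterE => i; congr eval.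
by apply: funext => j; rewrite /upoint; case: ifP.
Qed.

End Ultrapower.

(** * Compactness of the type spaces *)

Lemma type_spaceP (R : realType) (L : signature R)
    (f : forall N : structure L, N -> N -> R) (M : structure L)
    (p : type_space f M) :
  complete_types f (type_value p).
Proof. exact: set_mem (valP p). Qed.

Section TypeSpaceCompactness.
Variables (R : realType) (L : signature R).
Variable f : forall N : structure L, N -> N -> R.
Variable psi : formula L 2.
Hypothesis f_psi : forall (N : structure L) (c b : N), f c b = value psi c b.

Lemma type_value_bound (M : structure L) (p : type_space f M) b :
  `|type_value p b| <= bound psi.
Proof.
have [N [h [c [_ pc]]]] := type_spaceP p.
by rewrite pc f_psi; exact: eval_bound.
Qed.

Lemma complete_type_near (M : structure L) (p : M -> R) (k : nat)
    (b : 'I_k -> M) (e : R) :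
  @complete_types R L f M p -> 0 < e ->
  exists a, forall i, `|f a (b i) - p (b i)| < e.
Proof.
move=> [N [h [c [eh pc]]]] e0.
have [|a ha] := @complete_type_approx R L psi M p k b e _ e0.
  by exists N, h, c; split=> // b'; rewrite pc f_psi.
by exists a => i; rewrite f_psi.
Qed.

(** The elements that approximate [q] within [e] on a finite list form a filter base. *)
Lemma approx_ultrafilter (M : structure L) (q : M -> R) :
  (forall k (b : 'I_k -> M) e, 0 < e ->
     exists a, forall i, `|f a (b i) - q (b i)| < e) ->
  exists U : set_system M, UltraFilter U /\
    forall b, f a b @[a --> U] --> q b.
Proof.
move=> happ.
pose B (se : seq M * R) := [set a | forall b, b \in se.1 -> `|f a b - q b| < se.2].
pose F := filter_from [set se : seq M * R | 0 < se.2] B.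
have FF : ProperFilter F.
  apply: filter_from_proper; last first.
    move=> [s e] /= e0.
    have [a ha] := happ _ (tnth (in_tuple s)) e e0.
    exists a => b /= /(nthP point)[i si <-].
    by have := ha (Ordinal si); rewrite (tnth_nth point).
  apply: filter_from_filter; first by exists ([::], 1) => /=.
  move=> [s e] [s' e'] /= e0 e0'; exists (s ++ s', Num.min e e').
    by rewrite /= lt_min e0.
  move=> a ha; split=> b bs; have := ha b; rewrite /= mem_cat bs ?orbT;
    by rewrite lt_min => /(_ isT)/andP[].
have [U [UU FU]] := ultraFilterLemma FF.
exists U; split=> // b; apply/cvgrPdist_lt => e e0.
apply: FU; exists ([:: b], e) => //= a ha.
by rewrite distrC; apply: ha; rewrite inE.
Qed.

Lemma complete_type_net (M : structure L) (p : M -> R) :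
  @complete_types R L f M p ->
  exists U : set_system M, UltraFilter U /\ forall b, f a b @[a --> U] --> p b.
Proof.
by move=> pc; apply: approx_ultrafilter => k b e; exact: complete_type_near.
Qed.

(** The class of [a] in the ultrapower along the same [U] realizes the limit. *)
Lemma limit_complete_type (M : structure L) (I : Type) (U : set_system I)
    (a : I -> M) (q : M -> R) :
  UltraFilter U -> (forall b, f (a i) b @[i --> U] --> q b) ->
  @complete_types R L f M q.
Proof.
move=> UU aq; exists (ultrapower M UU), (diag UU), (ucl UU a).
split; first exact: diag_elementary.
move=> b; apply: (cvg_unique (@Rhausdorff R) (aq b)).
suff : f (a i) b @[i --> U] --> f (ucl UU a : ultrapower M UU) (diag UU b) by [].
rewrite f_psi; under eq_cvg do rewrite f_psi.
exact: (@value_ultrapower R L M I U UU psi a (fun=> b)).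
Qed.

Definition mk_type (M : structure L) (q : M -> R)
    (cq : @complete_types R L f M q) : type_space f M :=
  exist _ (q : {ptws M -> R}) (mem_set cq).

(** An ultrafilter of types converges pointwise to some function [q]. Finite approximability by
    elements of [M] passes from types to [q], and it suffices for [q] to be a type. *)
Lemma type_space_compact (M : structure L) : compact [set: type_space f M].
Proof.
rewrite compact_ultra => G GU _.
have /choice[q hq] b : exists l, type_value p b @[p --> G] --> (l : R).
  have [|l _ h] := @ultra_cvg_bounded R _ G (fun p => type_value p b) (bound psi) GU.
    by move=> p; exact: type_value_bound.
  by exists l.
have [|U [UU Uq]] := @approx_ultrafilter M q.
  move=> k b e e0; have e2 : 0 < e / 2 by rewrite divr_gt0.
  have : \forall p \near G, forall i, `|q (b i) - type_value p (b i)| < e / 2.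
    by apply: filter_forall => i; apply: (cvgrPdist_lt _ _).1 e2; exact: hq.
  move=> /filter_ex[p hp].
  have [a ha] := complete_type_near b (type_spaceP p) e2.
  exists a => i; rewrite [e]splitr.
  have := ltrD (ha i) (hp i); apply: le_lt_trans.
  rewrite (distrC (q _)).
  by apply: le_trans (ler_normD _ _); rewrite addrA subrK.
have cq := limit_complete_type UU Uq.
exists (mk_type cq); split=> //.
by apply/(cvg_type_space (F := G) id) => b; exact: hq.
Qed.

End TypeSpaceCompactness.

Section FormulaTypes.
Variables (R : realType) (L : signature R) (phi : formula L 2).

(** Types in [y] are types in [x] for the swapped formula, so results on [type_space] stated for a
    general [f] cover both sides. *)
Definition swap_formula : formula L 2 :=
  rename phi (fun i => if i == ord0 then ord_max else ord0).

Lemma value_swap (N : structure L) (c a : N) :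
  value phi a c = value swap_formula c a.
Proof. by rewrite value_rename. Qed.

Lemma ytype_compact (M : structure L) : compact [set: ytype phi M].
Proof. exact: (@type_space_compact R L (fun N c a => value phi a c) swap_formula value_swap). Qed.

Lemma ytype_hausdorff (M : structure L) : hausdorff_space (ytype phi M).
Proof. exact: type_space_hausdorff. Qed.

Lemma yvalue_continuous (M : structure L) (a : M) :
  continuous (fun q : ytype phi M => yvalue q a).
Proof. exact: type_value_continuous. Qed.

Lemma yvalue_bound (M : structure L) (q : ytype phi M) a :
  `|yvalue q a| <= bound phi.
Proof.
have [N [h [c [_ pc]]]] := type_spaceP q.
by rewrite /yvalue pc; exact: eval_bound.
Qed.

Definition ytp (M : structure L) (b : M) : ytype phi M :=
  realized (fun N c a => value phi a c) b.

Lemma ytype_net (M : structure L) (q : ytype phi M) :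
  exists U : set_system M, UltraFilter U /\
    forall a, value phi a b @[b --> U] --> yvalue q a.
Proof. exact: (@complete_type_net R L (fun N c a => value phi a c) swap_formula value_swap _ _ (type_spaceP q)). Qed.

Lemma xtype_net (M : structure L) (p : xtype phi M) :
  exists U : set_system M, UltraFilter U /\ xtp phi @ U --> p.
Proof.
have [U [UU h]] := @complete_type_net R L (fun N c b => value phi c b) phi (fun _ _ _ => erefl) M _ (type_spaceP p).
by exists U; split=> //; apply/cvg_type_space.
Qed.

Lemma yvalue_unif_cont (M : structure L) (e : R) : 0 < e ->
  exists2 d, 0 < d & forall (a a' : M), mdist a a' < d ->
    forall q : ytype phi M, `|yvalue q a - yvalue q a'| < e.
Proof.
move=> e0; have [d [/= hd d0]] :=
  filter_ex (filterI (eval_unif_cont phi e0) (nbhs_right_gt (0 : R))).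
exists d => // a a' aa' q.
have [N [h [c [eh pc]]]] := type_spaceP q.
rewrite /yvalue !pc; apply: hd => i; case: ifP => _.
  by rewrite elementary_isometry.
by rewrite mdistxx.
Qed.

End FormulaTypes.

(** * Radon measures from contents *)

Lemma open_borel (S : ptopologicalType) (A : set S) :
  open A -> measurable (A : set (Borel S)).
Proof. by move=> oA; apply: sub_sigma_algebra. Qed.

Lemma closed_borel (S : ptopologicalType) (A : set S) :
  closed A -> measurable (A : set (Borel S)).
Proof.
by move=> cA; rewrite -[A]setCK; apply: measurableC; apply: open_borel; exact: closed_openC.
Qed.

Section ContentMeasure.
Variables (R : realType) (K : ptopologicalType).
Hypotheses (hK : hausdorff_space K) (cK : compact [set: K]).
Variable l0 : set K -> R.
Hypothesis l0D : forall A B, A `&` B = set0 -> l0 (A `|` B) = l0 A + l0 B.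
Hypothesis l0_ge0 : forall A, 0 <= l0 A.
Hypothesis l0T : l0 setT = 1.

Lemma content0 : l0 set0 = 0.
Proof. by have := @l0D set0 set0 (set0I _); rewrite setU0; lra. Qed.

Lemma content_le A B : A `<=` B -> l0 A <= l0 B.
Proof.
move=> AB; rewrite -(setDUK AB) l0D ?lerDl//.
by rewrite setDE setIC -setIA setICl setI0.
Qed.

Lemma content_leU A B : l0 (A `|` B) <= l0 A + l0 B.
Proof.
have -> : A `|` B = A `|` (B `\` A).
  apply/seteqP; split=> x [Ax|]; [by left|move=> Bx|by left|by case; right].
  by have [Ax|nAx] := pselect (A x); [left|right].
rewrite l0D; last by rewrite setDE setICA setICr setI0.
by rewrite lerD2l content_le//; exact: subDsetl.
Qed.

Lemma content_le1 A : l0 A <= 1.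
Proof. by rewrite -l0T; exact: content_le. Qed.

(** The finitely additive [l0], given on all subsets, is regularized: from inside by closed sets,
    then from outside by open sets. The resulting measure is Radon, and on closed sets it can only
    exceed [l0]. *)
Definition inner_vals (G : set K) := [set l0 C | C in [set C | closed C /\ C `<=` G]].
Definition inner_content (G : set K) : R := sup (inner_vals G).

Lemma has_sup_inner G : has_sup (inner_vals G).
Proof.
split; first by exists (l0 set0), set0 => //; split=> //; exact: closed0.
by exists 1 => _ [C _ <-]; exact: content_le1.
Qed.

Lemma inner_content_ge G C : closed C -> C `<=` G -> l0 C <= inner_content G.
Proof. by move=> cC CG; apply: sup_upper_bound; [exact: has_sup_inner|exists C]. Qed.

Lemma inner_content_le G x : (forall C, closed C -> C `<=` G -> l0 C <= x) ->
  inner_content G <= x.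
Proof.
move=> h; apply: ge_sup; first by have [] := has_sup_inner G.
by move=> _ [C [? ?] <-]; exact: h.
Qed.

Lemma inner_content_ge0 G : 0 <= inner_content G.
Proof. by rewrite -content0 inner_content_ge//; exact: closed0. Qed.

Lemma inner_content_le1 G : inner_content G <= 1.
Proof. by apply: inner_content_le => C _ _; exact: content_le1. Qed.

Lemma inner_content_mono G H : G `<=` H -> inner_content G <= inner_content H.
Proof.
move=> GH; apply: inner_content_le => C cC CG; apply: inner_content_ge => //.
exact: subset_trans GH.
Qed.

(** By normality, a closed set contained in the union is covered by two closed sets, one inside [G]
    and one inside [H]. *)
Lemma inner_contentU G H : open G -> open H ->
  inner_content (G `|` H) <= inner_content G + inner_content H.
Proof.
move=> oG oH; apply: inner_content_le => C cC CGH.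
have cCH : closed (C `\` H) by apply: closedI => //; exact: open_closedC.
have nG : set_nbhs (C `\` H) G.
  by apply/set_nbhsP; exists G; split=> // x [/CGH[]].
have [V /set_nbhsP[W [oW CW WV]] VG] := compact_normal hK cK cCH nG.
have : C `<=` (C `&` closure V) `|` (C `\` W).
  move=> x Cx; have [Wx|nWx] := pselect (W x); last by right.
  by left; split=> //; apply: subset_closure; exact: WV.
move/content_le => /le_trans; apply; apply: le_trans (content_leU _ _) _.
apply: lerD; apply: inner_content_ge.
- by apply: closedI => //; exact: closed_closure.
- by move=> x [_ /VG].
- by apply: closedI => //; exact: open_closedC.
- by move=> x [Cx nWx]; apply: contrapT => nHx; apply: nWx; exact: CW.
Qed.

Lemma inner_content_bigU (G : nat -> set K) n : (forall i, open (G i)) ->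
  inner_content (\bigcup_(i < n) G i) <= \sum_(i < n) inner_content (G i).
Proof.
move=> oG; elim: n => [|n IH].
  rewrite bigcup_mkord big_ord0 big_ord0; apply: inner_content_le => C _.
  by rewrite subset0 => ->; rewrite content0.
rewrite big_ord_recr/= bigcup_mkord big_ord_recr/= -bigcup_mkord.
apply: le_trans (inner_contentU _ _) _ => //; last by rewrite lerD2r.
exact: bigcup_open.
Qed.

Lemma compact_seq_cover (C : set K) (G : nat -> set K) :
  closed C -> (forall i, open (G i)) -> C `<=` \bigcup_i G i ->
  exists n, C `<=` \bigcup_(i < n) G i.
Proof.
move=> cC oG CG.
have cpC : compact C by apply: subclosed_compact cC cK _.
move: cpC => /compact_near_coveringP/(_ nat \oo (fun n => \bigcup_(i < n) G i)).
case=> [x Cx|N _ hN]; last by exists N => x Cx; apply: hN => /=.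
have [i _ Gx] := CG _ Cx.
exists (G i, [set n | (i < n)%N]); first by split=> /=; [apply: open_nbhs_nbhs; split|exists i.+1].
by move=> [y n] /= [Gy ni]; exists i.
Qed.

Definition outer_vals (A : set K) := [set inner_content G | G in [set G | open G /\ A `<=` G]].
Definition outer_content (A : set K) : R := inf (outer_vals A).

Lemma has_inf_outer A : has_inf (outer_vals A).
Proof.
split; first by exists (inner_content setT), setT => //; split=> //; exact: openT.
by exists 0 => _ [G _ <-]; exact: inner_content_ge0.
Qed.

Lemma outer_content_le A G : open G -> A `<=` G -> outer_content A <= inner_content G.
Proof.
by move=> oG AG; apply: ge_inf; [have [] := has_inf_outer A|exists G].
Qed.

Lemma outer_content_ge A x : (forall G, open G -> A `<=` G -> x <= inner_content G) ->
  x <= outer_content A.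
Proof.
move=> h; apply: lb_le_inf; first by have [] := has_inf_outer A.
by move=> _ [G [? ?] <-]; exact: h.
Qed.

Lemma outer_content_adh A e : 0 < e ->
  exists G, [/\ open G, A `<=` G & inner_content G < outer_content A + e].
Proof.
move=> e0; have [_ [G [oG AG] <-] h] := inf_adherent e0 (has_inf_outer A).
by exists G.
Qed.

Lemma inner_content_adh G e : 0 < e ->
  exists C, [/\ closed C, C `<=` G & inner_content G - e < l0 C].
Proof.
move=> e0; have [_ [C [oC CG] <-] h] := sup_adherent e0 (has_sup_inner G).
by exists C.
Qed.

Lemma outer_content_open G : open G -> outer_content G = inner_content G.
Proof.
move=> oG; apply/eqP; rewrite eq_le outer_content_le//=.
by apply: outer_content_ge => H _; exact: inner_content_mono.
Qed.

Lemma outer_content_ge0 A : 0 <= outer_content A.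
Proof. by apply: outer_content_ge => G _ _; exact: inner_content_ge0. Qed.

Lemma outer_content_mono A B : A `<=` B -> outer_content A <= outer_content B.
Proof.
move=> AB; apply: outer_content_ge => G oG BG; apply: outer_content_le => //.
exact: subset_trans BG.
Qed.

Lemma outer_contentT : outer_content setT = 1.
Proof.
rewrite outer_content_open; last exact: openT.
apply/eqP; by rewrite eq_le inner_content_le1 -l0T inner_content_ge//; exact: closedT.
Qed.

Definition outer_contentE (A : set K) : \bar R := (outer_content A)%:E.

Lemma outer_contentE0 : outer_contentE set0 = 0%E.
Proof.
congr (_%:E); apply/eqP; rewrite eq_le outer_content_ge0 andbT.
apply: le_trans (outer_content_le open0 (@subset_refl _ set0)) _.
by apply: inner_content_le => C _; rewrite subset0 => ->; rewrite content0.
Qed.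

Lemma outer_contentE_ge0 A : (0 <= outer_contentE A)%E.
Proof. by rewrite lee_fin outer_content_ge0. Qed.

Lemma outer_contentE_mono : {homo outer_contentE : A B / A `<=` B >-> (A <= B)%E}.
Proof. by move=> A B AB; rewrite lee_fin outer_content_mono. Qed.

Lemma sum_geo_le (e : R) n : 0 < e -> \sum_(i < n) e / (2 ^+ i.+1) <= e.
Proof.
move=> e0; suff -> : \sum_(i < n) e / (2 ^+ i.+1) = e - e / 2 ^+ n.
  by rewrite gerBl divr_ge0 ?ltW ?exprn_gt0.
elim: n => [|n IH]; first by rewrite big_ord0 expr0 divr1 subrr.
rewrite big_ord_recr/= IH exprS; have : (2 : R) ^+ n != 0 by rewrite expf_neq0.
by move=> h; field.
Qed.

(** Each [F i] is enclosed in an open set with error [e / 2 ^+ i.+1]. A closed set inside the union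
    of these open sets is, by compactness, inside finitely many of them, which leaves finite
    subadditivity. *)
Lemma outer_contentE_sigma : sigma_subadditive outer_contentE.
Proof.
move=> F; apply/lee_addgt0Pr => e e0.
have /choice[G hG] i : exists G, [/\ open G, F i `<=` G &
    inner_content G < outer_content (F i) + e / 2 ^+ i.+1].
  by apply: outer_content_adh; rewrite divr_gt0 ?exprn_gt0.
have oG i : open (G i) by have [] := hG i.
apply: (@le_trans _ _ (inner_content (\bigcup_i G i))%:E).
  rewrite lee_fin; apply: outer_content_le; first exact: bigcup_open.
  by move=> x [i _ Fx]; exists i => //; have [_ + _] := hG i; apply.
have [->|fin] := eqVneq (\sum_(i <oo) outer_contentE (F i))%E +oo%E.
  by rewrite leey.
have [s hs] : exists s : R, (\sum_(i <oo) outer_contentE (F i))%E = s%:E.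
  exists (fine (\sum_(i <oo) outer_contentE (F i))%E); rewrite fineK//.
  rewrite ge0_fin_numE ?ltey//; apply: nneseries_ge0 => i _ _.
  exact: outer_contentE_ge0.
rewrite hs -EFinD lee_fin; apply: inner_content_le => C cC CG.
have [n Cn] := compact_seq_cover cC oG CG.
apply: le_trans (inner_content_ge cC Cn) _.
apply: le_trans (inner_content_bigU n oG) _.
apply: (@le_trans _ _ (\sum_(i < n) (outer_content (F i) + e / 2 ^+ i.+1))).
  by apply: ler_sum => i _; apply: ltW; have [] := hG i.
rewrite big_split/= lerD ?sum_geo_le//.
rewrite -lee_fin -hs -sumEFin.
rewrite -(big_mkord xpredT (fun i => outer_contentE (F i))).
by apply: nneseries_lim_ge => i _ _; exact: outer_contentE_ge0.
Qed.

HB.instance Definition _ := isOuterMeasure.Build R K outer_contentE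
  outer_contentE0 outer_contentE_ge0 outer_contentE_mono outer_contentE_sigma.

(** Given an open [H] containing [X], choose a closed [C] filling [H] inside [G], then a closed [C']
    filling [H] minus [C]. Removing [C] instead of [G] keeps the remainder open, and [C], [C'] are
    disjoint subsets of [H], on which [l0] is additive. *)
Lemma open_caratheodory G : open G -> outer_contentE.-caratheodory G.
Proof.
move=> oG; apply: le_caratheodory_measurable => X.
rewrite /= /outer_contentE -EFinD lee_fin.
apply: outer_content_ge => H oH XH; apply/ler_addgt0Pr => e e0.
have e2 : 0 < e / 2 by rewrite divr_gt0.
have [C [cC CHG hC]] := inner_content_adh (H `&` G) e2.
have [C' [cC' CH' hC']] := inner_content_adh (H `&` ~` C) e2.
have oHG : open (H `&` G) by exact: openI.
have oHC : open (H `&` ~` C) by apply: openI => //; exact: closed_openC.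
have h1 : outer_content (X `&` G) <= inner_content (H `&` G).
  by apply: outer_content_le => // x [/XH].
have h2 : outer_content (X `&` ~` G) <= inner_content (H `&` ~` C).
  by apply: outer_content_le => // x [/XH Hx nGx]; split=> // /CHG[].
have h3 : l0 C + l0 C' <= inner_content H.
  rewrite -l0D; last by apply/seteqP; split=> // x [Cx /CH'[]].
  apply: inner_content_ge; first exact: closedU.
  by move=> x [/CHG[]|/CH'[]].
by lra.
Qed.

Lemma borel_caratheodory (A : set (Borel K)) :
  measurable A -> outer_contentE.-caratheodory A.
Proof.
have sub : <<s [set: K], @open K >> `<=`
    (measurable : set (set (caratheodory_type outer_contentE))).
  apply: smallest_sub; first exact: sigma_algebra_measurable.
  exact: open_caratheodory.
exact: sub.
Qed.

Definition content_measure (A : set (Borel K)) : \bar R := outer_contentE A.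

Lemma content_measure0 : content_measure set0 = 0%E.
Proof. exact: outer_contentE0. Qed.

Lemma content_measure_ge0 A : (0 <= content_measure A)%E.
Proof. exact: outer_contentE_ge0. Qed.

Lemma content_measure_sigma : semi_sigma_additive content_measure.
Proof.
move=> F mF tF mUF; apply: caratheodory_measure_sigma_additive => //.
- by move=> i; exact: borel_caratheodory.
- exact: borel_caratheodory.
Qed.

HB.instance Definition _ := isMeasure.Build _ (Borel K) R content_measure
  content_measure0 content_measure_ge0 content_measure_sigma.

Lemma content_measureT : content_measure setT = 1%E.
Proof. by rewrite /content_measure /outer_contentE outer_contentT. Qed.

HB.instance Definition _ := Measure_isProbability.Build _ (Borel K) R
  content_measure content_measureT.

Lemma content_measureC (A : set (Borel K)) : measurable A ->
  outer_content (~` A) = 1 - outer_content A.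
Proof.
move=> mA; have := @borel_caratheodory A mA setT.
rewrite !setTI /= /outer_contentE outer_contentT => -[h]; lra.
Qed.

Lemma content_measure_closed C : closed C -> ((l0 C)%:E <= content_measure C)%E.
Proof.
move=> cC; rewrite lee_fin; apply: outer_content_ge => G _ CG.
exact: inner_content_ge.
Qed.

(** The complement of an open set enclosing the complement of [A] is a closed, hence compact, subset
    of [A]. *)
Lemma content_measure_radon : is_radon (content_measure : probability (Borel K) R).
Proof.
move=> A mA; apply/eqP; rewrite eq_le; apply/andP; split; last first.
  by apply: ge_ereal_sup => _ [C [_ CA] <-]; exact: outer_contentE_mono.
apply/lee_addgt0Pr => e e0.
have [G [oG AG hG]] := outer_content_adh (~` A) e0.
have cG : closed (~` G) by exact: open_closedC.
apply: (@le_trans _ _ (content_measure (~` G) + e%:E)%E); last first.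
  rewrite leeD2r//; apply: ereal_sup_ubound; exists (~` G) => //; split.
    exact: subclosed_compact cG cK _.
  by rewrite -[A]setCK; exact: subsetC.
rewrite /= /content_measure /outer_contentE -EFinD lee_fin.
have h1 := content_measureC (closed_borel cG); rewrite setCK in h1.
have h2 := content_measureC mA.
rewrite -(outer_content_open oG) in hG.
by move: h1 h2 hG; set x := outer_content (~` A); set y := outer_content A;
  set z := outer_content G; set t := outer_content (~` G); lra.
Qed.

Lemma radon_of_content : exists2 mu : probability (Borel K) R, is_radon mu &
  forall C, closed C -> ((l0 C)%:E <= mu C)%E.
Proof.
exists content_measure; first exact: content_measure_radon.
exact: content_measure_closed.
Qed.

End ContentMeasure.

(** * Pointwise limits of NIP families *)

Lemma compact_decreasing (T : topologicalType) (C : set T) (F : nat -> set T) :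
  compact C -> (forall n, closed (F n)) ->
  (forall n m, (n <= m)%N -> F m `<=` F n) -> (forall n, C `&` F n !=set0) ->
  exists2 x, C x & forall n, F n x.
Proof.
move=> cC cF decF CF0.
pose G := filter_from [set: nat] (fun n => C `&` F n).
have GF : ProperFilter G.
  apply: filter_from_proper => [|n _]; last exact: CF0.
  apply: filter_from_filter; first by exists 0%N.
  move=> i j _ _; exists (maxn i j) => // x [Cx Fx].
  by split; split=> //; apply: decF Fx; rewrite ?leq_maxl ?leq_maxr.
have [|x [Cx clx]] := cC G GF; first by exists 0%N => // x [].
exists x => // n; apply: cF => B nB.
have [|y [[_ Fy] By]] := clx (C `&` F n) B _ nB; first by exists n.
by exists y.
Qed.

Lemma bigcap_recr (T : Type) (A : nat -> set T) n :
  \bigcap_(i < n.+1) A i = (\bigcap_(i < n) A i) `&` A n.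
Proof.
apply/seteqP; split=> x.
  by move=> h; split=> [i /= ni|]; apply: h => //=; exact: ltnW.
move=> [h An] i /=; rewrite ltnS leq_eqVlt => /orP[/eqP -> //|ni].
exact: h.
Qed.

(** [NIP_on phi M] is the instance [f a q = yvalue q a], up to conversion. *)
Definition subsequentially_cvg (R : realType) (I S : Type) (f : I -> S -> R) :=
  forall a : nat -> I, exists2 h : nat -> nat, increasing_seq h &
    forall b, cvgn (fun n => f (a (h n)) b).

Section OuterMeasure.
Variables (R : realType) (S : ptopologicalType) (mu : probability (Borel S) R).
Hypothesis hS : hausdorff_space S.
Hypothesis radon : is_radon mu.
Implicit Types A B X : set S.

Definition om (A : set S) : R := fine ((mu^*)%mu (A : set (Borel S))).

Lemma mu_ext_le1 A : ((mu^*)%mu (A : set (Borel S)) <= 1)%E.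
Proof.
apply: (@le_trans _ _ ((mu^*)%mu [set: Borel S])); first exact: le_mu_ext.
by rewrite (measurable_mu_extE mu measurableT) probability_le1.
Qed.

Lemma omE A : (mu^*)%mu (A : set (Borel S)) = (om A)%:E.
Proof.
rewrite /om fineK// ge0_fin_numE ?mu_ext_ge0//.
by apply: le_lt_trans (mu_ext_le1 A) _; rewrite ltry.
Qed.

Lemma om_ge0 A : 0 <= om A.
Proof. by rewrite -lee_fin -omE mu_ext_ge0. Qed.

Lemma om0 : om set0 = 0.
Proof. by rewrite /om mu_ext0. Qed.

Lemma om_mono A B : A `<=` B -> om A <= om B.
Proof. by move=> AB; rewrite -lee_fin -!omE; exact: le_mu_ext. Qed.

Lemma omU A B : om (A `|` B) <= om A + om B.
Proof. by rewrite -lee_fin EFinD -!omE; exact: outer_measureU2. Qed.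

Lemma om_bigcup0 (F : nat -> set S) : (forall n, om (F n) = 0) ->
  om (\bigcup_n F n) = 0.
Proof.
move=> F0; apply/eqP; rewrite eq_le om_ge0 andbT -lee_fin -omE.
apply: le_trans (mu_ext_sigma_subadditive (measure_ge0 mu) F) _.
by rewrite eseries0// => i _ _; rewrite omE F0.
Qed.

Lemma om_measurable (A : set (Borel S)) : measurable A -> (om A)%:E = mu A.
Proof. by move=> mA; rewrite -omE measurable_mu_extE. Qed.

Lemma om_compact_approx V e : measurable (V : set (Borel S)) -> 0 < e ->
  exists C : set S, [/\ compact C, C `<=` V & om (V `\` C) < e].
Proof.
move=> mV e0.
have h := radon mV.
have [_ [C [cC CV] <-] hC] : exists2 x, [set mu K | K in [set K : set S | compact K /\ K `<=` V]] x &
    (mu V - e%:E < x)%E.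
  apply/ereal_sup_gt; rewrite -h -om_measurable// -EFinB lte_fin; lra.
have mC : measurable (C : set (Borel S)) by apply: closed_borel; exact: compact_closed.
exists C; split=> //.
have : mu V = (mu C + mu (V `\` C))%E.
  rewrite -measureU//; first by rewrite setDUK.
  - exact: measurableD.
  - by rewrite setDE setICA setICr setI0.
rewrite -!om_measurable//; last exact: measurableD.
move: hC; rewrite -!om_measurable// -EFinB lte_fin -EFinD => h1 [h2].
by lra.
Qed.

(* tau-additivity of Radon measures, for outer measure *)
Lemma charged_point X : 0 < om X ->
  exists2 x, X x & forall G, open G -> G x -> 0 < om (G `&` X).
Proof.
move=> X0; apply: contrapT => nex.
have /choice[G hG] x : exists G : set S, X x -> [/\ open G, G x & om (G `&` X) = 0].
  have [Xx|nXx] := pselect (X x); last by exists set0.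
  apply: contrapT => nG; apply: nex; exists x => // G oG Gx.
  rewrite lt_neqAle om_ge0 andbT; apply/negP => /eqP h; apply: nG.
  by exists G.
pose V := \bigcup_(x in X) G x.
have oV : open V by apply: bigcup_open => x /hG[].
have [C [cC CV VC]] := om_compact_approx (open_borel oV) X0.
have XC : 0 < om (C `&` X).
  have : om X <= om ((C `&` X) `|` (V `\` C)).
    apply: om_mono => x Xx; have [Cx|nCx] := pselect (C x); [by left|right].
    by split=> //; exists x => //; have [] := hG x Xx.
  by have := omU (C `&` X) (V `\` C); lra.
(* The sets that contain almost all of [C] intersected with [X]. By compactness they cluster at a
   point of [C]; but that point lies in some [G y], whose complement belongs to [F]. *)
pose F := [set A | om ((C `&` X) `\` A) = 0].
have FF : ProperFilter F.
  apply: Build_ProperFilter_ex.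
    move=> A FA; apply: contrapT => nA; move: XC; rewrite -FA; apply/negP.
    rewrite -leNgt; apply: om_mono => x h; split=> // Ax; apply: nA.
    by exists x.
  split.
  - rewrite /F/= setDT; apply/eqP; rewrite eq_le om_ge0 andbT.
    by rewrite -lee_fin -omE mu_ext0.
  - move=> A B FA FB; rewrite /F/= setDIr; apply/eqP; rewrite eq_le om_ge0 andbT.
    by apply: le_trans (omU _ _) _; rewrite FA FB addr0.
  - move=> A B AB FA; apply/eqP; rewrite eq_le om_ge0 andbT -[leRHS]FA.
    by apply: om_mono => x [h nBx]; split=> // /AB.
have [|x [Cx clx]] := cC F FF.
  rewrite /F/=; apply/eqP; rewrite eq_le om_ge0 andbT -lee_fin -omE.
  by rewrite (_ : _ `\` _ = set0) ?mu_ext0//; apply/seteqP; split=> // z [[]].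
have [y Xy Gyx] := CV _ Cx; have [oG Gy G0] := hG y Xy.
have [||z []//] := clx (~` G y) (G y).
  rewrite /F/=; apply/eqP; rewrite eq_le om_ge0 andbT -[leRHS]G0.
  by apply: om_mono => z [[_ Xz] /contrapT].
by apply: open_nbhs_nbhs; split.
Qed.

Section Pointwise.
Variables (I : Type) (F : set_system I) (f : I -> S -> R) (h g : S -> R).
Hypothesis FF : ProperFilter F.
Hypothesis cf : forall i, continuous (f i).
Hypothesis fh : forall b, f i b @[i --> F] --> h b.
Hypothesis fg : forall d e : R, 0 < d -> 0 < e ->
  \forall i \near F, om [set b | d <= `|f i b - g b|] < e.
Hypothesis sub : subsequentially_cvg f.

Definition side (al be : R) (i : I) (t : bool) : set S :=
  if t then [set b | be <= f i b] else [set b | f i b <= al].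

Lemma side_closed al be i t : closed (side al be i t).
Proof.
case: t; rewrite /side.
- apply: (@closed_comp _ _ (f i) [set x | be <= x]); last exact: closed_ge.
  by move=> ? _; exact: cf.
- apply: (@closed_comp _ _ (f i) [set x | x <= al]); last exact: closed_le.
  by move=> ? _; exact: cf.
Qed.

(** For most [i], [f i] exceeds [be] at a charged point of each [X], where [h] does; by continuity
    it does so on a neighbourhood, which charges the large side. For most [i] also, [f i] is close
    to [g], hence at most [al'], on [X] outside a set of smaller outer measure than [X], which
    charges the small side. *)
Lemma split_charged (al al' be : R) (D : set S) (Xs : seq (set S)) :
  al < al' -> D `<=` [set b | g b < al /\ be < h b] ->
  (forall X, X \in Xs -> X `<=` D /\ 0 < om X) ->
  exists i, forall X, X \in Xs -> forall t, 0 < om (X `&` side al' be i t).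
Proof.
move=> alal' Dgh hX.
pose X (j : 'I_(size Xs)) := nth set0 Xs j.
have {}hX j : X j `<=` D /\ 0 < om (X j) by apply: hX; exact: mem_nth.
suff [i hi] : exists i, forall j t, 0 < om (X j `&` side al' be i t).
  exists i => Y /(nthP set0)[j js <-] t; exact: (hi (Ordinal js)).
have /choice[x hx] j : exists x, X j x /\ forall G, open G -> G x -> 0 < om (G `&` X j).
  by have [x ? ?] := charged_point (hX j).2; exists x.
have n1 : \forall i \near F, forall j, be < f i (x j).
  apply: filter_forall => j; apply: (cvgr_gt _ (@fh (x j))).
  by have [/(hX j).1/Dgh[]] := hx j.
have n2 : \forall i \near F, forall j,
    om [set b | al' - al <= `|f i b - g b|] < om (X j).
  by apply: filter_forall => j; apply: fg; [rewrite subr_gt0|exact: (hX j).2].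
have [i [h1 h2]] := filter_ex (filterI n1 n2).
exists i => j [].
- have [_ /(_ [set b | be < f i b])] := hx j.
  move=> /(_ _ (h1 j)) H; apply: lt_le_trans (H _) _.
    by apply: (@open_comp _ _ (f i) [set x | be < x]) => [? _|]; [exact: cf|exact: open_gt].
  by apply: om_mono => b [/= /ltW ? ?].
- have : om (X j) <= om ((X j `&` side al' be i false) `|`
      [set b | al' - al <= `|f i b - g b|]).
    apply: om_mono => b Xb; have [fb|fb] := leP (f i b) al'; [by left|right].
    have [gb _] := Dgh _ ((hX j).1 _ Xb).
    by rewrite /= ger0_norm; lra.
  move=> H; have := omU (X j `&` side al' be i false) [set b | al' - al <= `|f i b - g b|].
  by have := h2 j; lra.
Qed.

Lemma null_between (al be : R) : al < be ->
  om [set b | g b < al /\ be < h b] = 0.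
Proof.
move=> albe; apply: contrapT => /eqP D0.
set D1 := [set b | _] in D0.
have {}D0 : 0 < om D1 by rewrite lt_neqAle eq_sym D0 om_ge0.
have [C [cC _ hC]] := om_compact_approx (@measurableT _ (Borel S)) D0.
(* Restricting to a compact set lets infinite patterns be realized once all finite ones are. *)
pose D := D1 `&` C.
have D00 : 0 < om D.
  have : om D1 <= om (D `|` (setT `\` C)).
    apply: om_mono => x Dx; have [Cx|nCx] := pselect (C x); [by left|by right].
  by have := omU D (setT `\` C); lra.
(* The passage from [g] to [f i] uses up the gap from [al] to [al']; the gap from [al'] to [be] is
   kept for the oscillation. *)
pose al' := (al + be) / 2.
have alal' : al < al' by rewrite /al'; lra.
have al'be : al' < be by rewrite /al'; lra.
pose good (Xs : seq (set S)) := forall X, X \in Xs -> X `<=` D /\ 0 < om X.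
have /choice[nxt hnxt] Xs : exists i, good Xs ->
    forall X, X \in Xs -> forall t, 0 < om (X `&` side al' be i t).
  have [gX|] := pselect (good Xs); last by have [i _] := filter_ex (@filterT _ F _); exists i.
  have [|i hi] := @split_charged al al' be D Xs alal' _ gX; first by move=> x [].
  by exists i.
(* One level of a binary tree: every set of the list is cut into its large and its small part for a
   common new index. *)
pose ext Xs := [seq X `&` side al' be (nxt Xs) t | X <- Xs, t <- [:: true; false]].
pose st n := iter n ext [:: D].
have gst n : good (st n).
  elim: n => [|n IH]; first by move=> X; rewrite mem_seq1 => /eqP ->; split.
  move=> X /allpairsP[[Y t] /= [Yn _ ->]]; split; last exact: hnxt.
  by move=> x [Yx _]; exact: (IH _ Yn).1.
pose a n := nxt (st n).
have branch (s : nat -> bool) n :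
    D `&` \bigcap_(i < n) side al' be (a i) (s i) \in st n.
  elim: n => [|n IH]; first by rewrite bigcap_mkord big_ord0 setIT inE.
  rewrite bigcap_recr setIA.
  apply/allpairsP; exists (D `&` \bigcap_(i < n) side al' be (a i) (s i), s n).
  by split=> //=; case: (s n); rewrite !inE.
have [k kinc hk] := sub a.
have kinj : injective k by apply: inc_inj => n m; exact: kinc.
(* The pattern is large exactly at the even-numbered terms of the subsequence [k], so that a point
   realizing it makes the subsequence diverge. *)
pose s j := `[< exists m, j = k m.*2 >].
have [|||x Cx hx] := @compact_decreasing S C
    (fun n => \bigcap_(i < n) side al' be (a i) (s i)) cC.
- by move=> n; apply: closed_bigI => i _; exact: side_closed.
- by move=> n m nm x hx i /= ni; apply: hx => /=; exact: leq_trans nm.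
- move=> n; have [_ /lt0r_neq0] := gst n _ (branch s n).
  have [[b [[_ Cb] hb]] _|/set0P/negP/negPn/eqP ->] :=
    pselect ((D `&` \bigcap_(i < n) side al' be (a i) (s i)) !=set0).
    by exists b.
  by rewrite om0 eqxx.
have {}hx i : side al' be (a i) (s i) x by apply: (hx i.+1); exact: ltnSn.
have := hk x => /cvg_ex[l fl].
have : be <= l.
  rewrite leNgt; apply/negP => lbe.
  have [N _ hN] := cvgr_lt _ fl _ lbe.
  have := hN N.*2; rewrite /= -addnn leq_addr addnn => /(_ isT).
  have := hx (k N.*2); have -> : s (k N.*2) by apply/asboolP; exists N.
  by rewrite /side/=; lra.
have : l <= al'.
  rewrite leNgt; apply/negP => lbe.
  have [N _ hN] := cvgr_gt _ fl _ lbe.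
  have := hN N.*2.+1; rewrite /= -addnn -addnS leq_addr addnS addnn => /(_ isT).
  have := hx (k N.*2.+1).
  have -> : s (k N.*2.+1) = false.
    apply/asboolP => -[m /kinj /(congr1 odd)]; rewrite /= !odd_double//.
  by rewrite /side/=; lra.
by lra.
Qed.

Lemma null_gt : om [set b | g b < h b] = 0.
Proof.
pose G n := if unpickle n is Some (p, q) then
  (if p < q :> rat then [set b | g b < ratr p /\ ratr q < h b] else set0) else set0.
apply/eqP; rewrite eq_le om_ge0 andbT.
have <- : om (\bigcup_n G n) = 0.
  apply: om_bigcup0 => n; rewrite /G; case: unpickle => [[p q]|].
    case: ifPn => pq; last by rewrite om0.
    by apply: null_between; rewrite ltr_rat.
  by rewrite om0.
apply: om_mono => b /= gh.
have [q] := rat_in_itvoo gh; rewrite in_itv/= => /andP[gq qh].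
have [p] := rat_in_itvoo gq; rewrite in_itv/= => /andP[gp pq].
have [n hn] : exists n, unpickle n = Some (p, q).
  by exists (pickle (p, q)); exact: pickleK.
exists n; first by [].
rewrite /G hn.
by rewrite -(@ltr_rat R) pq.
Qed.

End Pointwise.

Lemma pointwise_limit_ae (I : Type) (F : set_system I) (f : I -> S -> R)
    (h g : S -> R) :
  ProperFilter F -> (forall i, continuous (f i)) ->
  (forall b, f i b @[i --> F] --> h b) ->
  (forall d e : R, 0 < d -> 0 < e ->
    \forall i \near F, om [set b | d <= `|f i b - g b|] < e) ->
  subsequentially_cvg f ->
  om [set b | h b <> g b] = 0.
Proof.
move=> FF cf fh fg sub; apply/eqP; rewrite eq_le om_ge0 andbT.
have h1 := null_gt FF cf fh fg sub.
have h2 : om [set b | - g b < - h b] = 0.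
  apply: (@null_gt I F (fun i b => - f i b) (fun b => - h b) (fun b => - g b)) => //.
  - by move=> i x; apply: cvgN; exact: cf.
  - by move=> b; apply: cvgN; exact: fh.
  - move=> d e d0 e0; apply: filterS (fg d e d0 e0) => i.
    by congr (om _ < _); apply: eq_set => b; rewrite -opprD normrN.
  - move=> a; have [k ki hk] := sub a; exists k => // b.
    apply: is_cvgN; exact: hk.
have := omU [set b | g b < h b] [set b | - g b < - h b].
rewrite h1 h2 addr0; apply: le_trans; apply: om_mono => b /= /eqP.
by rewrite neq_lt => /orP[hg|gh]; [right; rewrite /= ltrN2|left].
Qed.

End OuterMeasure.

(** * NIP implies almost definability *)

Lemma near_lt_ereal (R : realType) (u : nat -> \bar R) (e : \bar R) :
  u n @[n --> \oo] --> 0%E -> (0 < e)%E -> \forall n \near \oo, (u n < e)%E.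
Proof.
move=> u0 e0; apply: (u0 [set x | (x < e)%E]).
by apply: open_nbhs_nbhs; split; [exact: open_ereal_lt_ereal|].
Qed.

(** * The L1 distance of measurable functions *)

Section LOneDistance.
Context d (T : measurableType d) (R : realType).
Variable nu : {measure set T -> \bar R}.
Hypothesis nuT : nu setT = 1%E.

Lemma full_ae (A : set T) : measurable A -> nu A = 1%E -> \forall b \ae nu, A b.
Proof.
move=> mA A1; exists (~` A); split; [exact: measurableC| |by []].
have nuC : nu setT = (nu A + nu (~` A))%E.
  rewrite -measureU; [by rewrite setUv|by []|exact: measurableC|exact: setICr].
move: nuC; rewrite nuT A1; case: (nu (~` A)) => [r| |].
- by rewrite -EFinD => -[h]; have -> : r = 0 by lra.
- by rewrite addey.
- by rewrite addeNy.
Qed.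

Local Open Scope ereal_scope.

Definition l1 (u v : T -> R) : \bar R :=
  \int[nu]_(b in [set: T]) (`|u b - v b|)%:E.

Lemma measurable_l1 (u v : T -> R) :
  measurable_fun setT u -> measurable_fun setT v ->
  measurable_fun [set: T] (fun b : T => (`|u b - v b|)%:E).
Proof.
move=> mfu mfv; apply/measurable_EFinP; apply: measurableT_comp => //.
exact: measurable_funB.
Qed.

Lemma l1_ge0 u v : 0 <= l1 u v.
Proof. by apply: integral_ge0 => b _; rewrite lee_fin. Qed.

Lemma l1_sym u v : l1 u v = l1 v u.
Proof. by apply: eq_integral => b _; rewrite distrC. Qed.

Lemma l1_triangle (v u w : T -> R) : measurable_fun setT u ->
  measurable_fun setT v -> measurable_fun setT w ->
  l1 u w <= l1 u v + l1 v w.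
Proof.
move=> mfu mfv mw; rewrite -ge0_integralD//; [|exact: measurable_l1..].
apply: ge0_le_integral => //; [exact: measurable_l1| |].
  by apply: emeasurable_funD; exact: measurable_l1.
move=> b _; rewrite -EFinD lee_fin.
by apply: le_trans (ler_normD _ _); rewrite addrA subrK.
Qed.

Lemma l1_cvg (u : nat -> T -> R) (v : T -> R) (c : R) :
  (forall n, measurable_fun setT (u n)) ->
  (forall n b, (`|u n b| <= c)%R) -> (forall b, u n b @[n --> \oo] --> v b) ->
  measurable_fun setT v /\ l1 (u n) v @[n --> \oo] --> 0.
Proof.
move=> mfu uc uv.
have mfv : measurable_fun setT v by apply: (measurable_fun_cvg mfu) => b _.
split=> //.
have [|||||_ + _] := @dominated_convergence _ T R nu setT measurableT
  (fun n b => (u n b)%:E) (fun b => (v b)%:E) (fun=> c%:E).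
- by move=> n; exact/measurable_EFinP.
- exact/measurable_EFinP.
- by apply: aeW => b _; apply: cvg_EFin; [exact: nearW|exact: uv].
- apply: measurable_bounded_integrable => //.
  + by rewrite nuT ltry.
  + by exists `|c|%R; split=> // x cx b _; exact: ltW.
- by apply: aeW => b n _; rewrite lee_fin.
by [].
Qed.

Lemma l1_markov (u v : T -> R) (r e : R) : measurable_fun setT u ->
  measurable_fun setT v -> (0 < r)%R -> l1 u v < (r * e)%:E ->
  nu [set b | r <= `|u b - v b|]%R < e%:E.
Proof.
move=> mfu mfv r0 uve.
have := @le_integral_comp_abse _ T R nu setT measurableT
  (fun b => (u b - v b)%:E) r id (@measurable_id _ _ _) (fun _ => id).
have -> : \int[nu]_(b in [set: T]) `|(u b - v b)%:E| = l1 u v.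
  by apply: eq_integral.
rewrite setTI => /(_ _ _ r0)/le_lt_trans H.
have {}H : r%:E * nu [set b | (r <= `|u b - v b|)%R] < (r * e)%:E.
  by apply: H uve => //; apply/measurable_EFinP; exact: measurable_funB.
by move: H; rewrite EFinM lte_pmul2l.
Qed.

Lemma l1_ae (u v u' v' : T -> R) : measurable_fun setT u ->
  measurable_fun setT v -> measurable_fun setT u' -> measurable_fun setT v' ->
  (\forall b \ae nu, u b = u' b) -> (\forall b \ae nu, v b = v' b) ->
  l1 u v = l1 u' v'.
Proof.
move=> m1 m2 m3 m4 uu vv; apply: ae_eq_integral => //; [exact: measurable_l1..|].
have FF : Filter (almost_everywhere nu) by exact: ae_filter_ringOfSetsType.
by apply: filterS2 uu vv => b /= -> -> _.
Qed.

Lemma l1_le_cst (u v : T -> R) (c : R) : measurable_fun setT u ->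
  measurable_fun setT v -> (forall b, `|u b - v b| <= c)%R -> l1 u v <= c%:E.
Proof.
move=> mfu mfv uvc; have -> : c%:E = c%:E * nu setT by rewrite nuT mule1.
rewrite -integral_cst//; apply: ge0_le_integral => //; [exact: measurable_l1|].
by move=> b _; rewrite lee_fin.
Qed.

End LOneDistance.

Lemma near_all_List (I J : Type) (U : set_system I) (P : J -> I -> Prop) (s : seq J) :
  Filter U -> (forall j, \forall i \near U, P j i) ->
  \forall i \near U, forall j, List.In j s -> P j i.
Proof.
move=> FU h; elim: s => [|j s IH]; first by apply: filterE.
by apply: filterS2 (h j) IH => i hj hs j' [<-|]; [|exact: hs].
Qed.

Section LOne.
Variables (R : realType) (S : ptopologicalType) (mu : probability (Borel S) R).
Hypothesis hS : hausdorff_space S.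
Hypothesis radon : is_radon mu.

Notation T := (completed_type mu).
Notation nu := (completion mu).

Lemma completion_omE (A : set S) : nu (A : set T) = (om mu A)%:E.
Proof. exact: omE. Qed.

Lemma completion_setT : nu [set: T] = 1%E.
Proof. exact: etrans (measurable_mu_extE mu measurableT) (probability_setT mu). Qed.

Lemma borel_completed (A : set S) : measurable (A : set (Borel S)) ->
  measurable (A : set T).
Proof. exact: caratheodory_measurable_mu_ext. Qed.

Lemma om0_measurable (A : set S) : om mu A = 0 -> measurable (A : set T).
Proof.
move=> A0; apply: le_caratheodory_measurable => X.
have XA0 : om mu (X `&` A) = 0.
  by apply/eqP; rewrite eq_le om_ge0 andbT -[leRHS]A0; apply: om_mono => x [].
rewrite /= !omE XA0 add0r lee_fin.
by apply: om_mono => x [].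
Qed.

Lemma om0_ae (P : set S) : om mu (~` P) = 0 -> \forall b \ae nu, P b.
Proof.
move=> P0; exists (~` P : set T); split=> //; first exact: om0_measurable.
by rewrite -[LHS]/(nu _) completion_omE P0.
Qed.

Lemma om0_full (A : set S) : om mu (~` A) = 0 ->
  measurable (A : set T) /\ nu (A : set T) = 1%E.
Proof.
move=> A0; split.
  by rewrite -[A]setCK; apply: (@measurableC _ T); exact: om0_measurable.
rewrite completion_omE; congr (_%:E).
have h1 : om mu setT = 1.
  by apply: EFin_inj; rewrite -completion_omE completion_setT.
apply/eqP; rewrite eq_le -{1}h1 om_mono//= -h1 -[om mu A]addr0 -A0.
by apply: le_trans (omU _ _ _); rewrite setUv.
Qed.

Lemma continuous_completed (f : S -> R) : continuous f ->
  measurable_fun [set: T] (f : T -> R).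
Proof.
move=> /continuousP cf; apply: (measurability _ (RGenOpens.measurableE R)).
move=> _ [_ [a [b ->] <-]]; rewrite setTI.
by apply: borel_completed; apply: open_borel; apply: cf; exact: interval_open.
Qed.

Section Family.
Variables (I : Type) (U : set_system I) (f : I -> S -> R) (h : S -> R) (c : R).
Hypothesis UU : UltraFilter U.
Hypothesis cf : forall i, continuous (f i).
Hypothesis fc : forall i b, `|f i b| <= c.
Hypothesis fh : forall b, f i b @[i --> U] --> h b.
Hypothesis sub : subsequentially_cvg f.

Let mf i : measurable_fun [set: T] (f i : T -> R).
Proof. exact: continuous_completed. Qed.

Lemma l1_subseq (a : nat -> I) : exists k g, [/\ increasing_seq k,
  forall b, f (a (k n)) b @[n --> \oo] --> g b,
  measurable_fun [set: T] (g : T -> R) &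
  l1 nu (f (a (k n))) g @[n --> \oo] --> 0%E].
Proof.
have [k ki hk] := sub a.
exists k, (fun b => lim (f (a (k n)) b @[n --> \oo])).
have hg b : f (a (k n)) b @[n --> \oo] --> lim (f (a (k n)) b @[n --> \oo]).
  exact: hk.
have [mg lg] := @l1_cvg _ T R nu completion_setT (fun n => f (a (k n))) _ c (fun n => mf (a (k n)))
  (fun n => @fc (a (k n))) hg.
by split.
Qed.

(** Otherwise, [U] being an ultrafilter, every [f i0] is at distance at least [e] from [f i] for
    most [i]. Recursion then gives an [e]-separated sequence, contrary to the L1-convergent
    subsequence of [l1_subseq]. *)
Lemma l1_cauchy (e : R) : 0 < e ->
  exists i0, \forall i \near U, (l1 nu (f i) (f i0) < e%:E)%E.
Proof.
move=> e0; apply: contrapT => nex.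
have far i0 : \forall i \near U, (e%:E <= l1 nu (f i) (f i0))%E.
  have : ~ U [set i | (l1 nu (f i) (f i0) < e%:E)%E] by move=> Ui; apply: nex; exists i0.
  move/(ultra_setC UU); apply: filterS => i /=.
  by rewrite leNgt => /negP.
have /choice[nxt hnxt] (s : seq I) : exists i, forall j, List.In j s ->
    (e%:E <= l1 nu (f i) (f j))%E.
  have := @near_all_List I I U (fun j i => (e%:E <= l1 nu (f i) (f j))%E) s _ far.
  by move=> /(_ (@filter_filter _ _ (@ultra_proper _ _ UU)))/filter_ex.
pose st := fix st n := if n is m.+1 then nxt (st m) :: st m else [::].
pose a n := nxt (st n).
have aIn n m : (m < n)%N -> List.In (a m) (st n).
  elim: n => // n IH; rewrite ltnS leq_eqVlt => /orP[/eqP ->|/IH]; first by left.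
  by right.
have [k [g [ki _ mg lg]]] := l1_subseq a.
have e2 : (0 < (e / 2)%:E)%E by rewrite lte_fin divr_gt0.
have [N _ hN] : \forall n \near \oo, (l1 nu (f (a (k n))) g < (e / 2)%:E)%E.
  exact: near_lt_ereal.
have h1 := hN N (leqnn N); have h2 := hN N.+1 (leqnSn N); rewrite /= in h1 h2.
have kN : (k N < k N.+1)%N by rewrite ltnNge -leEnat ki -ltnNge.
have := hnxt (st (k N.+1)) (a (k N)) (aIn _ _ kN).
apply/negP; rewrite -ltNge.
apply: le_lt_trans (l1_triangle nu (mf _) mg (mf _)) _.
by rewrite [e]splitr EFinD; apply: lteD => //; rewrite l1_sym.
Qed.

(** Choose [a n] such that most [f i] are within [1/(n+1)] of [f (a n)] in L1. The L1 limit [g] of a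
    subsequence is then the L1 limit along [U] as well, hence the limit in measure by Markov, as
    [pointwise_limit_ae] requires. *)
Lemma ae_sequential_limit : exists (k : nat -> I) (g : S -> R), [/\
  forall b, f (k n) b @[n --> \oo] --> g b,
  measurable_fun [set: T] (g : T -> R),
  l1 nu (f (k n)) g @[n --> \oo] --> 0%E &
  om mu [set b | h b <> g b] = 0].
Proof.
have /choice[a ha] (n : nat) : exists i0, \forall i \near U,
    (l1 nu (f i) (f i0) < (n.+1%:R^-1 : R)%:E)%E.
  by apply: l1_cauchy; rewrite invr_gt0.
have [k [g [ki kg mg lg]]] := l1_subseq a.
exists (a \o k), g; split=> //.
apply: (pointwise_limit_ae hS radon _ cf fh _ sub) => d e d0 e0.
(* Two errors of size [r] add up to [d * e], which Markov's inequality at level [d] turns into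
   [e]. *)
pose r := d * e / 2; have r0 : 0 < r by rewrite divr_gt0// mulr_gt0.
have n1 : \forall n \near \oo, (l1 nu (f (a (k n))) g < r%:E)%E.
  by apply: near_lt_ereal; rewrite ?lte_fin.
have n2 : \forall n \near \oo, (n.+1%:R^-1 : R) < r.
  exact: near_infty_natSinv_lt (PosNum r0).
have [n [h1 h2]] := filter_ex (filterI n1 n2); rewrite /= in h1 h2.
apply: filterS (ha (k n)) => i hi.
rewrite -lte_fin -completion_omE; apply: (l1_markov (mf i) mg d0).
apply: le_lt_trans (l1_triangle nu (mf i) (mf (a (k n))) mg) _.
have -> : d * e = r + r by rewrite /r -splitr.
rewrite EFinD; apply: lteD => //; apply: lt_trans hi _; rewrite lte_fin.
apply: le_lt_trans h2; rewrite lef_pV2 ?posrE// ler_nat ltnS.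
exact: mathcomp.classical.unstable.mono_leq_infl.
Qed.

End Family.

End LOne.

(** * Almost definability and density character under NIP *)

Section NIPDefinable.
Variables (R : realType) (L : signature R) (phi : formula L 2) (M : structure L).
Hypothesis nip : NIP_on phi M.
Variable mu : probability (Borel (ytype phi M)) R.
Hypothesis radon : is_radon mu.
Variable ev : xtype phi M -> ytype phi M -> R.
Hypothesis ev_eval : evaluation ev.

Notation T := (completed_type mu).
Notation nu := (completion mu).

Lemma ev_sequential_limit (p : xtype phi M) :
  exists (k : nat -> M) (g : ytype phi M -> R), [/\
    forall b, yvalue b (k n) @[n --> \oo] --> g b,
    measurable_fun [set: T] (g : T -> R),
    l1 nu (fun b => yvalue b (k n)) g @[n --> \oo] --> 0%E &
    om mu [set b | ev p b <> g b] = 0].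
Proof.
have [F [FF _ Fev]] := ev_eval.2 p.
have [U [UU FU]] := ultraFilterLemma FF.
apply: (@ae_sequential_limit _ _ mu (@ytype_hausdorff R L phi M) radon M U
  (fun a b => yvalue b a) (ev p) (bound phi)) => //.
- by move=> a; exact: yvalue_continuous.
- by move=> a b; exact: yvalue_bound.
- by move=> b A /Fev /FU.
Qed.

Lemma nip_almost_definable p : almost_definable mu ev p.
Proof.
have [k [g [kg mg _ evg]]] := ev_sequential_limit p.
exists g; first split=> //.
  exists (fun n b => yvalue b (k n)); split.
  - by move=> n; exact: yvalue_continuous.
  - by move=> n b; exact: yvalue_bound.
  - by apply: aeW => b; exact: kg.
by apply: om0_full.
Qed.

(** A class is within [e / 2] of some [phi(k n, .)] in L1, and replacing [k n] by a close element
    [d] of [D] changes the values uniformly by at most [e / 4]. *)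
Lemma nip_density (psi : xtype phi M -> ytype phi M -> R) :
  defining_relations mu ev psi ->
  density_le (@class_dist R L phi M mu psi) (@mdist R M).
Proof.
move=> hpsi D Ddense.
pose cl (d : M) : type_classes mu psi := \pi_(type_classes mu psi) (xtp phi d).
exists (cl @` D); last exact: card_image_le.
have mpsi p : measurable_fun [set: T] (psi p : T -> R) by have [[]] := hpsi p.
have psi_ev p : \forall b \ae nu, psi p b = ev p b.
  have [_ [mA A1]] := hpsi p.
  have : \forall b \ae nu, ev p b = psi p b by exact: (full_ae (completion_setT mu) mA A1).
  have FF : Filter (almost_everywhere nu) by exact: ae_filter_ringOfSetsType.
  by apply: filterS => b ->.
move=> x e e0; have e2 : 0 < e / 2 by rewrite divr_gt0.
have e4 : 0 < e / 4 by rewrite divr_gt0.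
have [k [g [kg mg lg evg]]] := ev_sequential_limit (repr x).
have [n hn] : exists n, (l1 nu (fun b => yvalue b (k n)) g < (e / 2)%:E)%E.
  by apply: (@filter_ex _ \oo); apply: near_lt_ereal lg _; rewrite lte_fin.
have [dl dl0 hdl] := yvalue_unif_cont phi M e4.
have [d Dd kd] := Ddense (k n) dl dl0.
exists (cl d); first by exists d.
rewrite /class_dist /ae_dist /Rintegral.
have mk a : measurable_fun [set: T] ((fun b => yvalue b a) : T -> R).
  by apply: continuous_completed; exact: yvalue_continuous.
have -> : (\int[nu]_(b in [set: T]) (`|psi (repr x) b - psi (repr (cl d)) b|)%:E)%E =
    l1 nu g (fun b => yvalue b d).
  have FF : Filter (almost_everywhere nu) by exact: ae_filter_ringOfSetsType.
  have h1 := psi_ev (repr x).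
  have h2 : \forall b \ae nu, ev (repr x) b = g b by apply: om0_ae.
  (* The representative of the class of [d] need not be the type of [d]; only the defining relations
     agree almost everywhere. *)
  have h3 : \forall b \ae nu, psi (repr (cl d)) b = psi (xtp phi d) b.
    have /eqmodP/asboolP : repr (cl d) = xtp phi d %[mod type_classes mu psi].
      by rewrite reprK.
    by [].
  have h4 := psi_ev (xtp phi d).
  apply: (l1_ae (mpsi _) (mpsi _) mg (mk d)).
    by apply: filterS2 h1 h2 => b ->.
  by apply: filterS2 h3 h4 => b -> ->; rewrite ev_eval.1.
have : (l1 nu g (fun b => yvalue b d) < e%:E)%E.
  apply: le_lt_trans (l1_triangle nu mg (mk (k n)) (mk d)) _.
  rewrite [e]splitr EFinD; apply: lteD; first by rewrite l1_sym.
  apply: (@le_lt_trans _ _ (e / 4)%:E); last by rewrite lte_fin; lra.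
  by apply: (l1_le_cst (completion_setT mu) (mk _) (mk _)) => b; rewrite ltW// hdl.
by have := l1_ge0 nu g (fun b => yvalue b d); case: (l1 _ _ _) => // r _; rewrite lte_fin.
Qed.

End NIPDefinable.

(** * The independence dichotomy *)

Lemma near_all_in (I : Type) (J : eqType) (U : set_system I)
    (P : J -> I -> Prop) (s : seq J) : Filter U ->
  (forall j, j \in s -> \forall i \near U, P j i) ->
  \forall i \near U, forall j, j \in s -> P j i.
Proof.
move=> FU; elim: s => [|j s IH] h; first by apply: filterE.
have h1 : \forall i \near U, P j i by apply: h; rewrite inE eqxx.
have h2 : \forall i \near U, forall j, j \in s -> P j i.
  by apply: IH => j' js; apply: h; rewrite inE js orbT.
apply: filterS2 h1 h2 => i hj hs j'.
by rewrite inE => /predU1P[->|/hs].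
Qed.

Fixpoint sublists (s : seq nat) : seq (seq nat) :=
  if s is x :: s' then sublists s' ++ map (cons x) (sublists s') else [:: [::]].

Lemma subseq_sublists s l : subseq s l -> s \in sublists l.
Proof.
elim: l s => [|x l IH] [|y s] //=; rewrite mem_cat.
  by move=> _; rewrite IH ?sub0seq.
case: eqP => [->|_] h; last by rewrite IH.
by rewrite map_f ?orbT// IH.
Qed.

Lemma sublistsP s l : s \in sublists l -> subseq s l.
Proof.
elim: l s => [|x l IH] s /=; first by rewrite inE => /eqP ->.
rewrite mem_cat => /orP[/IH h|/mapP[s' /IH h ->]]; last by rewrite /= eqxx.
exact: subseq_trans h (subseq_cons _ _).
Qed.

Lemma subseq_rcons_inv (s l : seq nat) n : subseq s (rcons l n) ->
  subseq s l \/ exists2 s', subseq s' l & s = rcons s' n.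
Proof.
elim: l s => [|x l IH] [|y s] /=; try by left.
  case: (y =P n) => [->|_] /eqP // ->.
  by right; exists [::].
case: eqP => [->|_] /IH[h|[s' h e]].
- by left.
- by right; exists (x :: s'); rewrite /= ?eqxx// e.
- by left.
- right; exists s' => //; case: s' h e => //= z s' h _.
  by case: eqP => // zx; exact: subseq_trans (subseq_cons _ _) h.
Qed.

Lemma ltn_sorted_subseq (s : seq nat) j t : sorted ltn s ->
  (forall x, x \in s -> (j <= x < t)%N) -> subseq s (iota j (t - j)).
Proof.
move=> ss st.
have -> : s = [seq x <- iota j (t - j) | x \in s].
  apply: (irr_sorted_eq ltn_trans ltnn ss).
    exact: sorted_filter ltn_trans _ _ (iota_ltn_sorted _ _).
  move=> x; rewrite mem_filter mem_iota; case: (boolP (x \in s)) => //= /st.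
  by move=> /andP[jx xt]; rewrite jx subnKC// (leq_trans jx)// ltnW.
exact: filter_subseq.
Qed.

Section UltrafilterRamsey.
Variables (U : set_system nat) (UU : UltraFilter U).
Hypothesis Ucof : \oo `<=` U.

(** Each new value of [h] lies in the finitely many large sets attached to the subsequences built so
    far, and above all earlier values. Requirement [j] concerns only the terms from position [j] on,
    so countably many requirements are met by one [h]. *)
Lemma ultra_diagonal (Q : nat -> seq nat -> Prop) :
  (forall j, Q j [::]) ->
  (forall j s, Q j s -> \forall n \near U, Q j (rcons s n)) ->
  exists2 h : nat -> nat, increasing_seq h & forall j s, sorted ltn s ->
    (forall x, x \in s -> (j <= x)%N) -> Q j (map h s).
Proof.
move=> Q0 Qstep.
pose Inv l := forall j s, subseq s (drop j l) -> Q j s.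
have inv_step l : Inv l -> exists n, Inv (rcons l n) /\ forall x, x \in l -> (x < n)%N.
  move=> Il.
  have n1 : \forall n \near U, forall j, j \in iota 0 (size l).+1 ->
      forall s, s \in sublists (drop j l) -> Q j (rcons s n).
    apply: near_all_in => j _; apply: near_all_in => s /sublistsP sl.
    exact: Qstep (Il _ _ sl).
  have n2 : \forall n \near U, forall x, x \in l -> (x < n)%N.
    by apply: near_all_in => x _; apply: Ucof; exists x.+1.
  have [n [h1 h2]] := filter_ex (filterI n1 n2).
  exists n; split=> // j s; have [jl|lj] := leqP j (size l).
    rewrite drop_rcons// => /subseq_rcons_inv[|[s' sl ->]]; first exact: Il.
    by apply: h1; [rewrite mem_iota|exact: subseq_sublists].
  by rewrite drop_oversize ?size_rcons// subseq0 => /eqP ->.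
have /choice[nxt hnxt] l : exists n, Inv l ->
    Inv (rcons l n) /\ forall x, x \in l -> (x < n)%N.
  have [/inv_step[n ?]|?] := pselect (Inv l); [by exists n|by exists 0%N].
pose st := fix st t := if t is t'.+1 then rcons (st t') (nxt (st t')) else [::].
pose h t := nxt (st t).
have stE t : st t = mkseq h t.
  by elim: t => //= t IH; rewrite mkseqS -IH.
have Ist t : Inv (st t).
  elim: t => [|t IH] /=; last by have [] := hnxt _ IH.
  by move=> j s; rewrite drop_oversize// subseq0 => /eqP ->.
have hlt : {homo h : m n / (m < n)%N}.
  move=> m n mn; have [_] := hnxt _ (Ist n); apply.
  by rewrite stE; apply: map_f; rewrite mem_iota.
exists h; first exact: leq_mono.
move=> j s ss sj; pose t := (\max_(x <- s) x).+1.
apply: (Ist t); rewrite stE /mkseq -map_drop drop_iota add0n.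
apply: map_subseq; apply: ltn_sorted_subseq => // x xs.
by rewrite sj//= ltnS; exact: leq_bigmax_seq.
Qed.

(** Membership in the [m]-fold Fubini power of [U], for continuations of the prefix [s]. *)
Fixpoint iter_ultra m (P : seq nat -> Prop) (s : seq nat) : Prop :=
  if m is m'.+1 then \forall n \near U, iter_ultra m' P (rcons s n) else P s.

Lemma iter_ultra_dichotomy m P s :
  iter_ultra m P s \/ iter_ultra m (fun s => ~ P s) s.
Proof.
elim: m s => [|m IH] s /=; first exact: EM.
have [|/(ultra_setC UU) h] := pselect (U [set n | iter_ultra m P (rcons s n)]).
  by left.
by right; apply: filterS h => n /=; have [] := IH (rcons s n).
Qed.

(** The invariant passed to [ultra_diagonal]. Lists longer than [m] are unconstrained, so that an
    extension is always possible. *)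
Definition ramsey_stage m (P : seq nat -> Prop) (s : seq nat) : Prop :=
  (size s <= m)%N -> iter_ultra (m - size s) P s.

Lemma ramsey_stage_step m P s : ramsey_stage m P s ->
  \forall n \near U, ramsey_stage m P (rcons s n).
Proof.
rewrite /ramsey_stage => h.
have [sm|ms] := ltnP (size s) m; last first.
  by apply: filterE => n; rewrite size_rcons ltnNge ms.
have := h (ltnW sm); rewrite -(subnSK sm) /=.
by apply: filterS => n ? _; rewrite size_rcons.
Qed.

Lemma ramsey_stageE m P s : size s = m -> ramsey_stage m P s -> P s.
Proof. by rewrite /ramsey_stage => <- /(_ (leqnn _)); rewrite subnn. Qed.

End UltrafilterRamsey.

Section Dichotomy.
Variables (R : realType) (I S : Type) (f : I -> S -> R).

(** The inequalities are strict, hence open conditions, so that points of the type space can be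
    replaced by realized ones. *)
Definition independent_of_length (al be : R) (k : nat) : Prop :=
  exists a : nat -> I, forall s : nat -> bool, exists b, forall i, (i < k)%N ->
    if s i then be < f (a i) b else f (a i) b < al.

Definition alternates (a : nat -> I) (al be : R) (s : seq nat) : Prop :=
  exists b, forall i, (i < size s)%N ->
    if odd i then f (a (nth 0%N s i)) b < al else be < f (a (nth 0%N s i)) b.

Lemma sorted_mkseq (x : nat -> nat) m : {homo x : i j / (i < j)%N} ->
  sorted ltn (mkseq x m).
Proof.
by move=> hx; rewrite /mkseq sorted_map;
  apply: sub_sorted (iota_ltn_sorted 0 m) => i j; exact: hx.
Qed.

(* In an increasing list of length [2 k] in which the [i]-th pair of positions
   is [3 i + 1, 3 i + 2] or [3 i, 3 i + 1], the position [3 i + 1] is even or odd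
   at will: alternation thus implies independence. *)
Lemma alternates_independent (a : nat -> I) (al be : R) k :
  (forall s, sorted ltn s -> size s = k.*2 -> alternates a al be s) ->
  independent_of_length al be k.
Proof.
move=> halt; exists (fun i => a (3 * i).+1) => s.
pose x j := (3 * j./2 + odd j + s j./2)%N.
have xS j : (x j < x j.+1)%N.
  rewrite /x /= uphalf_half; case: (odd j) => /=; rewrite ?add0n ?add1n; first last.
    by rewrite ltn_add2r; lia.
  by case: (s j./2); case: (s _) => /=; lia.
have xinc : {homo x : i j / (i < j)%N} by apply: homo_ltn => //; exact: ltn_trans.
have [b hb] := halt _ (sorted_mkseq k.*2 xinc) (size_mkseq _ _).
exists b => i ik.
pose j := (i.*2 + ~~ s i)%N.
have j2 : j./2 = i by rewrite /j; case: (s i); rewrite /= ?addn0 ?addn1 /= ?uphalf_double ?doubleK.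
have jo : odd j = ~~ s i by rewrite /j oddD odd_double oddb.
have jk : (j < k.*2)%N by rewrite /j; case: (s i) => /=; lia.
have := hb j; rewrite size_mkseq => /(_ jk); rewrite nth_mkseq// /x j2 jo.
by case: (s i) => /=; rewrite ?addn0 ?addn1.
Qed.

(** An ultrafilter limit [l] is a cluster value; divergence leaves infinitely many terms at distance
    at least [e] from [l], infinitely many of them on one side. Rational thresholds keep the pairs
    countable. *)
Lemma oscillation (v : nat -> R) (c : R) : (forall n, `|v n| <= c) ->
  ~ cvgn v -> exists p q : rat, [/\ p < q,
    forall N, exists2 n, (N < n)%N & ratr q < v n &
    forall N, exists2 n, (N < n)%N & v n < ratr p].
Proof.
move=> vc ncv.
have [U [UU FU]] := @ultraFilterLemma nat \oo _.
have [l _ vl] := @ultra_cvg_bounded R nat U v c UU vc.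
have near_l e : 0 < e -> forall N, exists2 n, (N < n)%N & `|l - v n| < e.
  move=> e0 N; have h1 : \forall n \near U, (N < n)%N by apply: FU; exists N.+1.
  have [n [? ?]] := filter_ex (filterI h1 ((cvgrPdist_lt _ _).1 vl e e0)).
  by exists n.
have [e e0 he] : exists2 e : R, 0 < e & forall N, exists2 n, (N < n)%N & e <= `|l - v n|.
  apply: contrapT => ne; apply: ncv; apply/cvg_ex; exists l.
  apply/cvgrPdist_lt => e e0; apply: contrapT => ne2; apply: ne; exists e => // N.
  apply: contrapT => ne3; apply: ne2; exists N.+1 => // n /= Nn.
  by rewrite ltNge; apply/negP => h; apply: ne3; exists n.
have e3 : 0 < e / 3 by rewrite divr_gt0.
have [up|nup] := pselect (forall N, exists2 n, (N < n)%N & l + e <= v n).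
  have [q] : exists q : rat, ratr q \in `]l + e / 3, l + e[ by apply: rat_in_itvoo; lra.
  rewrite in_itv/= => /andP[q1 q2].
  have [p] : exists p : rat, ratr p \in `]l + e / 3, (ratr q : R)[ by exact: rat_in_itvoo.
  rewrite in_itv/= => /andP[p1 p2].
  exists p, q; split; first by rewrite -(ltr_rat R).
    by move=> N; have [n Nn h] := up N; exists n => //; lra.
  move=> N; have [n Nn h] := near_l _ e3 N; exists n => //.
  by move: h; rewrite ltr_norml => /andP[]; lra.
have dn N : exists2 n, (N < n)%N & v n <= l - e.
  move/existsNP : nup => [N0 hN0].
  have [n] := he (maxn N N0); rewrite gtn_max => /andP[Nn N0n] hn.
  exists n => //; have : v n < l + e.
    by rewrite ltNge; apply/negP => ?; apply: hN0; exists n.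
  by move: hn; case: (ler0P (l - v n)); lra.
have [q] : exists q : rat, ratr q \in `]l - e, l - e / 3[ by apply: rat_in_itvoo; lra.
rewrite in_itv/= => /andP[q1 q2].
have [p] : exists p : rat, ratr p \in `]l - e, (ratr q : R)[ by exact: rat_in_itvoo.
rewrite in_itv/= => /andP[p1 p2].
exists p, q; split; first by rewrite -(ltr_rat R).
  move=> N; have [n Nn h] := near_l _ e3 N; exists n => //.
  by move: h; rewrite ltr_norml => /andP[]; lra.
by move=> N; have [n Nn h] := dn N; exists n => //; lra.
Qed.

(** For each rational pair, some length of alternation fails generically, since otherwise
    [ultra_diagonal] would produce independent families of the forbidden length. A second
    diagonalization makes these failures hold along one subsequence, on which no point can
    oscillate. *)
Lemma dependent_subsequentially_cvg (c : R) : (forall i b, `|f i b| <= c) ->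
  (forall al be, al < be -> exists k, ~ independent_of_length al be k) ->
  subsequentially_cvg f.
Proof.
move=> fc dep a.
have [U [UU FU]] := @ultraFilterLemma nat \oo _.
have /choice[m hm] (pq : rat * rat) : exists m, pq.1 < pq.2 ->
    iter_ultra U m (fun s => ~ alternates a (ratr pq.1) (ratr pq.2) s) [::].
  have [lt_pq|_] := boolP (pq.1 < pq.2); last by exists 0%N.
  have [|k nk] := dep (ratr pq.1) (ratr pq.2); first by rewrite ltr_rat.
  exists k.*2 => _.
  have [yes|//] := @iter_ultra_dichotomy U UU k.*2 (alternates a (ratr pq.1) (ratr pq.2)) [::].
  exfalso; apply: nk.
  have [||h hi hh] := @ultra_diagonal U UU FU (fun _ => ramsey_stage U k.*2 (alternates a (ratr pq.1) (ratr pq.2))).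
  - by move=> j _; rewrite subn0.
  - by move=> j s; exact: ramsey_stage_step.
  apply: (@alternates_independent (a \o h)) => s ss sk.
  have := hh 0%N s ss (fun _ _ => isT).
  move/ramsey_stageE; rewrite size_map => /(_ sk)[b hb].
  exists b => i is_; have := hb i; rewrite size_map => /(_ is_).
  by rewrite (nth_map 0%N).
(* Requirement [n] is that of the [n]-th rational pair; the default pair, not being increasing,
   imposes nothing. *)
pose code n : rat * rat := odflt (0, 0) (unpickle n).
have codeS pq : exists n, code n = pq.
  by exists (pickle pq); rewrite /code pickleK.
pose Q n s := (code n).1 < (code n).2 ->
  ramsey_stage U (m (code n)) (fun s => ~ alternates a (ratr (code n).1) (ratr (code n).2) s) s.
have [||h hi hh] := @ultra_diagonal U UU FU Q.
- by move=> j lt_pq _; rewrite subn0; exact: hm.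
- move=> j s Qs; have [lt_pq|nlt] := boolP ((code j).1 < (code j).2).
    by apply: filterS (ramsey_stage_step UU (Qs lt_pq)) => n ? _.
  by apply: filterE => n /=; rewrite /Q (negbTE nlt).
exists h => // b; apply: contrapT => ncv.
have [p [q [pq up dn]]] := @oscillation (fun n => f (a (h n)) b) c (fun n => fc _ b) ncv.
have [j cj] := codeS (p, q).
have /choice[g hg] (nt : nat * bool) : exists n, (nt.1 < n)%N /\
    (if nt.2 then f (a (h n)) b < ratr p else ratr q < f (a (h n)) b).
  by case: nt => n [] /=; [have [x ? ?] := dn n|have [x ? ?] := up n]; exists x.
(* All indices lie beyond [j], where requirement [j] is in force; even places take large values and
   odd places small ones. *)
pose x := fix x i := if i is i'.+1 then g (x i', odd i) else g (j, false).
have xS i : (x i < x i.+1)%N by have [] := hg (x i, odd i.+1).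
have xinc : {homo x : i j / (i < j)%N} by apply: homo_ltn => //; exact: ltn_trans.
have xj i : (j <= x i)%N.
  elim: i => [|i IH]; first by have [/ltnW] := hg (j, false).
  exact: leq_trans IH (ltnW (xS i)).
have xval i : if odd i then f (a (h (x i))) b < ratr p else ratr q < f (a (h (x i))) b.
  by case: i => [|i]; [have [] := hg (j, false)|have [] := hg (x i, odd i.+1)].
have := hh j (mkseq x (m (code j))) (sorted_mkseq _ xinc).
rewrite /Q cj /= => H.
have /H /(_ pq) : forall y, y \in mkseq x (m (p, q)) -> (j <= y)%N.
  by move=> y /mapP[i _ ->].
move=> /ramsey_stageE; rewrite size_map size_mkseq => /(_ erefl); apply.
exists b => i; rewrite size_map size_mkseq => im.
by rewrite (nth_map 0%N) ?size_mkseq// nth_mkseq.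
Qed.

End Dichotomy.

(** * Coin-flip measures *)

Section CoinFlips.
Variable R : realType.
Implicit Types g : seq bool -> R.

Fixpoint coin_mean n g : R :=
  if n is n'.+1 then
    (coin_mean n' (fun s => g (false :: s)) + coin_mean n' (fun s => g (true :: s))) / 2
  else g [::].

Lemma coin_mean_le n g g' : (forall s, size s = n -> g s <= g' s) ->
  coin_mean n g <= coin_mean n g'.
Proof.
elim: n g g' => [|n IH] g g' h /=; first exact: h.
rewrite ler_pM2r ?invr_gt0// lerD// IH// => s sn; apply: h => /=; by rewrite sn.
Qed.

Lemma eq_coin_mean n g g' : (forall s, size s = n -> g s = g' s) ->
  coin_mean n g = coin_mean n g'.
Proof.
by move=> h; apply/eqP; rewrite eq_le !coin_mean_le// => s /h ->.
Qed.

Lemma coin_mean_cst n (c : R) : coin_mean n (fun=> c) = c.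
Proof. by elim: n => //= n ->; lra. Qed.

Lemma coin_meanD n g g' :
  coin_mean n (fun s => g s + g' s) = coin_mean n g + coin_mean n g'.
Proof.
by elim: n g g' => //= n IH g g'; rewrite !IH; lra.
Qed.

Lemma coin_mean_flip n g : coin_mean n (fun s => g (map negb s)) = coin_mean n g.
Proof.
elim: n g => //= n IH g; rewrite addrC.
by rewrite (IH (fun s => g (false :: s))) (IH (fun s => g (true :: s))).
Qed.

Lemma coin_mean_cat m n g :
  coin_mean (m + n) g = coin_mean m (fun p => coin_mean n (fun s => g (p ++ s))).
Proof. by elim: m g => //= m IH g; rewrite !IH. Qed.

Definition ind (P : Prop) : R := (`[< P >])%:R.

Lemma ind_ge0 P : 0 <= ind P.
Proof. by rewrite /ind ler0n. Qed.

Lemma ind_le1 P : ind P <= 1.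
Proof. by rewrite /ind lern1 leq_b1. Qed.

Lemma indT P : P -> ind P = 1.
Proof. by move=> p; rewrite /ind asboolT. Qed.

Lemma indF P : ~ P -> ind P = 0.
Proof. by move=> p; rewrite /ind asboolF. Qed.

Lemma ind_le (P Q : Prop) : (P -> Q) -> ind P <= ind Q.
Proof.
move=> pq; have [p|np] := pselect P; last by rewrite (indF np) ind_ge0.
by rewrite !indT//; exact: pq.
Qed.

Lemma coin_mean_prefix n (t : seq bool) : (size t <= n)%N ->
  coin_mean n (fun s => ind (prefix t s)) = 2^-1 ^+ size t.
Proof.
elim: n t => [|n IH] [|x t] //= tn.
- by rewrite indT.
- have -> : (fun s => ind (prefix [::] (false :: s))) = (fun=> 1).
    by apply: funext => s; rewrite indT.
  by rewrite coin_mean_cst expr0; lra.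
rewrite exprS -(IH t)//; case: x => /=.
- have -> : (fun s => ind (false && prefix t s)) = (fun=> 0).
    by apply: funext => s; rewrite indF.
  by rewrite coin_mean_cst add0r mulrC.
- have -> : (fun s : seq bool => ind (false && prefix t s)) = (fun=> 0).
    by apply: funext => s; rewrite indF.
  by rewrite coin_mean_cst addr0 mulrC.
Qed.

(* If a tree of finite bit strings never contains two strings that differ
   exactly at all places from [m] on, its density halves from level [m] on;
   the infimum of the densities of a tree being positive, this fails for some
   [m]. *)
Lemma opposite_strings (S : seq bool -> Prop) (c : R) : 0 < c ->
  (forall p s, S (p ++ s) -> S p) ->
  (forall n, c <= coin_mean n (fun s => ind (S s))) ->
  exists m, forall k, exists p s, [/\ size p = m, size s = k, S (p ++ s) &
    S (p ++ map negb s)].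
Proof.
move=> c0 Spre hc.
pose r n := coin_mean n (fun s => ind (S s)).
have hi : has_inf (range r).
  by split; [exists (r 0%N), 0%N|exists c => _ [n _ <-]; exact: hc].
have cr : c <= inf (range r).
  by apply: lb_le_inf; [exact: hi.1|move=> _ [n _ <-]; exact: hc].
(* The margin is the infimum itself, which is positive: [r m] is less than twice the infimum. *)
have [_ [m _ <-] hm] := inf_adherent (lt_le_trans c0 cr) hi.
exists m => k; apply: contrapT => nex.
have : 2 * r (m + k)%N <= r m.
  rewrite /r coin_mean_cat mulr2n mulrDl mul1r -coin_meanD.
  apply: coin_mean_le => p pm; rewrite -[X in _ + X]coin_mean_flip -coin_meanD.
  rewrite -[leRHS](coin_mean_cst k); apply: coin_mean_le => s sk.
  have [S1|nS1] := pselect (S (p ++ s)); last first.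
    by rewrite (indF nS1) add0r; apply: ind_le; exact: Spre.
  rewrite (_ : ind (S (p ++ map negb s)) = 0) ?addr0.
    by apply: ind_le; exact: Spre.
  by apply: indF => S2; apply: nex; exists p, s.
have : inf (range r) <= r (m + k)%N by apply: ge_inf; [exact: hi.2|exists (m + k)%N].
by lra.
Qed.

End CoinFlips.

Section IndependentClosedSets.
Variables (R : realType) (K : ptopologicalType).
Hypotheses (hK : hausdorff_space K) (cK : compact [set: K]).
Variable Z : nat -> bool -> set K.
Hypothesis cZ : forall i t, closed (Z i t).
Hypothesis dZ : forall i, Z i true `&` Z i false = set0.
Variable pt : seq bool -> K.
Hypothesis ptZ : forall s i, Z i (nth false s i) (pt s).

Definition cylinders : set K := [set x | forall i, exists t, Z i t x].
Definition cyl (s : seq bool) : set K :=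
  [set x | cylinders x /\ forall i, (i < size s)%N -> Z i (nth false s i) x].

Lemma cylinders_closed : closed cylinders.
Proof.
have -> : cylinders = \bigcap_i (Z i true `|` Z i false).
  apply/seteqP; split=> x h i.
    by move=> _; have [[] ?] := h i; [left|right].
  by have [?|?] := h i I; [exists true|exists false].
by apply: closed_bigI => i _; exact: closedU.
Qed.

Lemma cyl_closed s : closed (cyl s).
Proof.
apply: closedI; first exact: cylinders_closed.
have -> : (fun x => forall i, (i < size s)%N -> Z i (nth false s i) x) =
  \bigcap_(i < size s) Z i (nth false s i) by [].
by apply: closed_bigI => i _; exact: cZ.
Qed.

Lemma pt_cylinders s : cylinders (pt s).
Proof. by move=> i; exists (nth false s i). Qed.

Lemma pt_cyl t s : prefix t s -> cyl t (pt s).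
Proof.
move=> /prefixP[s' ->]; split; first exact: pt_cylinders.
by move=> i it; have := ptZ (t ++ s') i; rewrite nth_cat it.
Qed.

Lemma cyl_split s : cyl s = cyl (rcons s false) `|` cyl (rcons s true).
Proof.
apply/seteqP; split=> x.
  move=> [Kx sx]; have [[] tx] := Kx (size s); [right|left]; split=> // i;
  by rewrite size_rcons ltnS leq_eqVlt nth_rcons => /orP[/eqP ->|is_];
    rewrite ?ltnn ?eqxx// is_; exact: sx.
by move=> [|] [Kx sx]; split=> // i is_; have := sx i;
  rewrite size_rcons ltnS nth_rcons is_ => /(_ (ltnW is_)).
Qed.

Lemma cyl_disj s : cyl (rcons s false) `&` cyl (rcons s true) = set0.
Proof.
apply/seteqP; split=> // x [[_ /(_ (size s))] + [_ /(_ (size s))]].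
rewrite !size_rcons !nth_rcons ltnn eqxx => /(_ (ltnSn _)) h1 /(_ (ltnSn _)) h2.
by have : (Z (size s) true `&` Z (size s) false) x by []; rewrite dZ.
Qed.

Lemma cyl_prefix p s : cyl (p ++ s) `<=` cyl p.
Proof.
move=> x [Kx h]; split=> // i ip; have := h i.
by rewrite size_cat nth_cat ip; apply; exact: leq_trans (leq_addr _ _).
Qed.

(** Average point masses at [pt s] over the strings of length [j], take the limit along [U], and
    regularize. Regularization only bounds closed sets from below; equality follows by induction, as
    the lower bounds of the two halves of a cylinder already exhaust its mass. *)
Lemma coin_flip_measure : exists2 mu : probability (Borel K) R, is_radon mu &
  mu cylinders = 1%E /\ forall p, mu (cyl p) = (2^-1 ^+ size p)%:E.
Proof.
have [U [UU FU]] := @ultraFilterLemma nat \oo _.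
pose fr j (V : set K) := coin_mean j (fun s => ind R (V (pt s))).
have fr_ge0 j V : 0 <= fr j V.
  by rewrite -(coin_mean_cst j (0 : R)); apply: coin_mean_le => s _; exact: ind_ge0.
have fr_le1 j V : fr j V <= 1.
  by rewrite -(coin_mean_cst j (1 : R)); apply: coin_mean_le => s _; exact: ind_le1.
have /choice[l0 hl0] V : exists l, fr j V @[j --> U] --> (l : R).
  have [|l _ ?] := @ultra_cvg_bounded R nat U (fr ^~ V) 1 UU.
    by move=> j; rewrite ger0_norm.
  by exists l.
have l0_eq V (l : R) : (\forall j \near U, fr j V = l) -> l0 V = l.
  move=> h; apply: (cvg_unique (@Rhausdorff R) (hl0 V)).
  by apply: cvg_near_cst.
have l0_ge V (l : R) : (\forall j \near U, l <= fr j V) -> l <= l0 V.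
  by move=> h; apply: (cvgr_to_ge (hl0 V)).
have [|||mu radon hmu] := @radon_of_content R K hK cK l0.
- move=> A B AB; apply: (cvg_unique (@Rhausdorff R) (hl0 _)).
  have -> : (fun j => fr j (A `|` B)) = (fun j => fr j A + fr j B).
    apply: funext => j; rewrite -coin_meanD; apply: eq_coin_mean => s _.
    have [As|nAs] := pselect (A (pt s)).
      have nB : ~ B (pt s).
        by move=> Bs; have : (A `&` B) (pt s) by []; rewrite AB.
      by rewrite (indF R nB) addr0 !indT//; left.
    rewrite (indF _ nAs) add0r; apply/eqP; rewrite eq_le !ind_le//.
      by right.
    by case.
  by apply: cvgD; exact: hl0.
- by move=> A; apply: l0_ge; apply: filterE.
- apply: l0_eq; apply: filterE => j; rewrite -[RHS](coin_mean_cst j).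
  by apply: eq_coin_mean => s _; rewrite indT.
exists mu => //.
have cl1 : mu cylinders = 1%E.
  apply/eqP; rewrite eq_le (probability_le1 mu (closed_borel cylinders_closed)) andTb.
  have <- : l0 cylinders = 1.
    apply: l0_eq; apply: filterE => j; rewrite -[RHS](coin_mean_cst j).
    by apply: eq_coin_mean => s _; rewrite indT//; exact: pt_cylinders.
  exact: hmu cylinders_closed.
split=> //.
have ge p : ((2^-1 ^+ size p)%:E <= mu (cyl p))%E.
  apply: (@le_trans _ _ (l0 (cyl p))%:E); last exact/hmu/cyl_closed.
  rewrite lee_fin; apply: l0_ge.
  apply: FU; exists (size p) => // j /= pj.
  rewrite -(coin_mean_prefix R pj); apply: coin_mean_le => s _.
  by apply: ind_le; exact: pt_cyl.
elim/last_ind => [|p x IH].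
  by rewrite -cl1; congr (mu _); apply/seteqP; split=> [y []|].
have : mu (cyl p) = (mu (cyl (rcons p false)) + mu (cyl (rcons p true)))%E.
  by rewrite cyl_split measureU//; [apply: closed_borel; exact: cyl_closed..|exact: cyl_disj].
have := ge (rcons p false); have := ge (rcons p true); rewrite IH.
rewrite -!om_measurable; [|apply: closed_borel; exact: cyl_closed..].
rewrite !size_rcons exprS !lee_fin -EFinD => h1 h2 [h3].
by congr (_%:E); case: x; lra.
Qed.

(** A cylinder of depth [n] has mass [2^-n], so the strings whose cylinders meet [C] have density at
    least [mu C] at every level. [opposite_strings] gives pairs in [C] that are opposite on
    arbitrarily long stretches from a fixed [m] on, and compactness of the square of [C] gives one
    pair for all places. *)
Lemma opposite_points (mu : probability (Borel K) R) (C : set K) :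
  mu cylinders = 1%E -> (forall p, mu (cyl p) = (2^-1 ^+ size p)%:E) ->
  closed C -> (0 < mu C)%E ->
  exists m x x', [/\ C x, C x' & forall i, (m <= i)%N ->
    exists t, Z i t x /\ Z i (~~ t) x'].
Proof.
move=> mu1 mucyl cC muC.
have mcyl p : measurable (cyl p : set (Borel K)) by apply: closed_borel; exact: cyl_closed.
have mC : measurable (C : set (Borel K)) by apply: closed_borel.
pose S p := C `&` cyl p !=set0.
have bound n p : om mu (C `&` cyl p) <=
    2^-1 ^+ size p * coin_mean n (fun s => ind R (S (p ++ s))).
  elim: n p => [|n IH] p /=.
    rewrite cats0; have [Sp|nSp] := pselect (S p).
      rewrite (indT R Sp) mulr1 -lee_fin -mucyl -om_measurable// lee_fin.
      exact: om_mono.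
    rewrite (indF R nSp) mulr0 (_ : C `&` cyl p = set0) ?om0//.
    by apply/seteqP; split=> // x Cx; apply: nSp; exists x.
  rewrite cyl_split setIUr; apply: le_trans (omU _ _ _) _.
  have := lerD (IH (rcons p false)) (IH (rcons p true)).
  move=> /le_trans; apply; rewrite !size_rcons exprS.
  have E t : (fun s => ind R (S (rcons p t ++ s))) = (fun s => ind R (S (p ++ t :: s))).
    by apply: funext => s; rewrite cat_rcons.
  by rewrite !E; lra.
have omC : om mu C = om mu (C `&` cyl [::]).
  apply/eqP; rewrite eq_le; apply/andP; split; last by apply: om_mono => x [].
  have : om mu C <= om mu ((C `&` cyl [::]) `|` ~` cylinders).
    apply: om_mono => x Cx; have [Kx|nKx] := pselect (cylinders x); last by right.
    by left; split=> //; split.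
  have K0 : om mu (~` cylinders) = 0.
    have mK := closed_borel cylinders_closed.
    apply: EFin_inj; rewrite om_measurable; last exact: measurableC.
    by rewrite probability_setC// mu1 subee.
  by have := omU mu (C `&` cyl [::]) (~` cylinders); rewrite K0; lra.
have [|||m hm] := @opposite_strings R S (om mu C).
- by rewrite -lte_fin om_measurable.
- by move=> p s [x [Cx /cyl_prefix]]; exists x.
- by move=> n; have := bound n [::]; rewrite -omC expr0 mul1r.
exists m.
pose F n := [set xx : K * K | forall i, (i < n)%N -> exists t, Z (m + i)%N t xx.1 /\ Z (m + i)%N (~~ t) xx.2].
have cCC : compact (C `*` C).
  by apply: compact_setX; apply: (subclosed_compact cC cK).
have [|||[x x'] [/= Cx Cx'] hx] := compact_decreasing (F := F) cCC.
- move=> n; have -> : F n = \bigcap_(i < n) (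
      (Z (m + i)%N true `*` Z (m + i)%N false) `|` (Z (m + i)%N false `*` Z (m + i)%N true)).
    apply/seteqP; split=> y h i ni.
      by have [[] [? ?]] := h i ni; [left|right].
    by have [[? ?]|[? ?]] := h i ni; [exists true|exists false].
  apply: closed_bigI => i _; apply: closedU; apply: closedI.
  + by apply: (@closed_comp _ _ (@fst K K)) => // y _; exact: cvg_fst.
  + by apply: (@closed_comp _ _ (@snd K K)) => // y _; exact: cvg_snd.
  + by apply: (@closed_comp _ _ (@fst K K)) => // y _; exact: cvg_fst.
  + by apply: (@closed_comp _ _ (@snd K K)) => // y _; exact: cvg_snd.
- by move=> n k nk y h i ni; apply: h; exact: leq_trans nk.
- move=> n; have [p [s [pm sn [x [Cx hx]] [x' [Cx' hx']]]]] := hm n.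
  exists (x, x'); split=> //= i ni; exists (nth false s i).
  have mi : (m + i < m)%N = false by rewrite ltnNge leq_addr.
  split=> /=.
    have := hx.2 (m + i)%N.
    by rewrite size_cat pm sn ltn_add2l nth_cat pm mi addKn => /(_ ni).
  have := hx'.2 (m + i)%N.
  rewrite size_cat size_map pm sn ltn_add2l nth_cat pm mi addKn => /(_ ni).
  by rewrite (nth_map false) ?sn.
exists x, x'; split=> // i mi.
by have := hx (i - m).+1 (i - m)%N (ltnSn _); rewrite subnKC.
Qed.

End IndependentClosedSets.

(** * Independent sequences in ultrapowers *)

Section IndependentSequences.
Variables (R : realType) (L : signature R) (phi : formula L 2).

Lemma realized_independent (M : structure L) (al be : R) k :
  independent_of_length (fun a (q : ytype phi M) => yvalue q a) al be k ->
  independent_of_length (fun a (b : M) => value phi a b) al be k.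
Proof.
move=> [a ha]; exists a => s; have [q hq] := ha s.
have [U [UU Uq]] := ytype_net q.
have : \forall b \near U, forall i : 'I_k,
    if s i then be < value phi (a i) b else value phi (a i) b < al.
  apply: filter_forall => i; have := hq i (ltn_ord i).
  case: (s i) => h.
  - exact: (cvgr_gt _ (Uq (a i)) _ h).
  - exact: (cvgr_lt _ (Uq (a i)) _ h).
move=> /filter_ex[b hb]; exists b => i ik.
exact: hb (Ordinal ik).
Qed.

(** Weak inequalities, which survive limits along ultrafilters. *)
Definition independent_sequence (M : structure L) (al be : R) (a : nat -> M) :=
  forall s : nat -> bool, exists b, forall i,
    if s i then be <= value phi (a i) b else value phi (a i) b <= al.

Variables (U : set_system nat) (UU : UltraFilter U).
Hypothesis Ucof : \oo `<=` U.

Lemma ultrapower_independent (M : structure L) (al be : R) :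
  (forall k, independent_of_length (fun a (b : M) => value phi a b) al be k) ->
  exists a : nat -> ultrapower M UU, independent_sequence al be a.
Proof.
move=> /choice[a ha].
(* The [k]-th coordinate comes from a family of length [k], so it controls the [i]-th term as soon
   as [i < k]. *)
exists (fun i => ucl UU (fun k => a k i)) => s.
have /choice[b hb] k := ha k s.
exists (ucl UU b) => i.
have near_i : \forall k \near U, (i < k)%N by apply: Ucof; exists i.+1.
have lim_i := @value_ultrapower R L M nat U UU phi (fun k => a k i) b.
case si : (s i).
- apply: (cvgr_to_ge lim_i); apply: filterS near_i => k ik.
  by have := hb k i ik; rewrite si => /ltW.
- apply: (cvgr_to_le lim_i); apply: filterS near_i => k ik.
  by have := hb k i ik; rewrite si => /ltW.
Qed.

(* The limit type of an independent sequence of [M] is not realized in the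
   ultrapower. Suppose that [c = (c_j)] realizes it. If for every [n], for most
   [j], some [b_j] has a large value at [c_j] and small values at
   [a_0, ..., a_(n-1)], then a diagonal [(b_j)] has a large value at [c] and
   small values at all the [a_i]. Otherwise, for some [n], a point [b] of [M]
   with small values at [a_i] for [i < n] and large values at the other [a_i]
   does not have a large value at [c]. *)
Lemma limit_not_realized (M : structure L) (al be : R) (a : nat -> M) :
  al < be -> independent_sequence al be a ->
  forall c : ultrapower M UU, ~ forall b : ultrapower M UU,
    value phi (diag UU (a i)) b @[i --> U] --> value phi c b.
Proof.
move=> albe inda c hc.
(* A threshold strictly between, contradicting [al] in the first case and [be] in the second. *)
pose ga := (al + be) / 2.
have alga : al < ga by rewrite /ga; lra.
have gabe : ga < be by rewrite /ga; lra.
pose C : nat -> M := repr c.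
have cE : c = ucl UU C by rewrite /ucl reprK.
pose good n j b := ga <= value phi (C j) b /\
  forall i, (i < n)%N -> value phi (a i) b <= al.
have good_le n m j b : (n <= m)%N -> good m j b -> good n j b.
  by move=> nm [h1 h2]; split=> // i ni; apply: h2; exact: leq_trans nm.
have [allP|] := pselect (forall n, U [set j | exists b, good n j b]).
  (* [b j] serves the largest [n <= j] that has a witness, and so, by monotonicity of [good], all
     the smaller ones. *)
  have /choice[b hb] j : exists b, forall n, (n <= j)%N ->
      (exists b', good n j b') -> good n j b.
    have : forall k, exists b, forall n, (n <= k)%N -> (exists b', good n j b') -> good n j b.
      elim=> [|k [b IH]].
        have [[b hb]|nb] := pselect (exists b, good 0%N j b).
          by exists b => n; rewrite leqn0 => /eqP ->.
        by exists point => n; rewrite leqn0 => /eqP ->.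
      have [[b' hb']|nb] := pselect (exists b, good k.+1 j b).
        by exists b' => n nk _; exact: good_le hb'.
      exists b => n; rewrite leq_eqVlt => /orP[/eqP -> //|]; exact: IH.
    by move=> /(_ j).
  have hC := @value_ultrapower R L M nat U UU phi C b.
  have h1 : ga <= value phi c (ucl UU b).
    rewrite cE; apply: (cvgr_to_ge hC).
    by apply: filterS (allP 0%N) => j /(hb j 0%N (leq0n j))[].
  have h2 i : value phi (diag UU (a i)) (ucl UU b) <= al.
    apply: (cvgr_to_le (@value_ultrapower R L M nat U UU phi (fun=> a i) b)).
    have near_i : \forall j \near U, (i < j)%N by apply: Ucof; exists i.+1.
    by apply: filterS2 near_i (allP i.+1) => j ij /(hb j i.+1 ij)[_]; apply.
  have : value phi c (ucl UU b) <= al.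
    by apply: (cvgr_to_le (@hc (ucl UU b))); apply: filterE.
  by lra.
move=> /existsNP[n /(ultra_setC UU) nP].
have [b hb] := inda (fun i => (n <= i)%N).
have h1 : value phi c (diag UU b) <= ga.
  rewrite cE; apply: (cvgr_to_le (@value_ultrapower R L M nat U UU phi C (fun=> b))).
  apply: filterS nP => j /= nj; rewrite leNgt; apply/negP => h; apply: nj.
  exists b; split=> [|i ni]; first exact: ltW.
  by have := hb i; rewrite leqNgt ni.
have : be <= value phi c (diag UU b).
  apply: (cvgr_to_ge (@hc (diag UU b))).
  have near_n : \forall i \near U, (n <= i)%N by apply: Ucof; exists n.
  apply: filterS near_n => i ni; have := hb i; rewrite ni.
  move=> /le_trans; apply; apply: (cvgr_to_ge (@value_ultrapower R L M nat U UU phi (fun=> a i) (fun=> b))).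
  exact: filterE.
by lra.
Qed.

End IndependentSequences.

(** * Evaluations of types *)

Section Evaluations.
Variables (R : realType) (L : signature R) (phi : formula L 2) (M : structure L).

(** Types in [y] are limits of elements of [M], on which [a] and [a'] agree. Hence an evaluation is
    well defined at realized types. *)
Lemma xtp_yvalue (a a' : M) : xtp phi a = xtp phi a' ->
  forall b : ytype phi M, yvalue b a = yvalue b a'.
Proof.
move=> aa' b; have [U [UU Ub]] := ytype_net b.
apply: (cvg_unique (@Rhausdorff R) (Ub a)).
have -> : value phi a = value phi a'; last exact: Ub.
by apply: funext => c; exact: (congr1 (fun p => type_value p c) aa').
Qed.

(* A type that is not realized can be evaluated along any prescribed
   ultrafilter. *)
Lemma evaluation_along (p : xtype phi M) (I : Type) (U : set_system I)
    (a : I -> M) (h : ytype phi M -> R) :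
  ProperFilter U -> (forall c, xtp phi c <> p) ->
  xtp phi (a i) @[i --> U] --> p ->
  (forall b, yvalue b (a i) @[i --> U] --> h b) ->
  exists2 ev, evaluation ev & ev p = h.
Proof.
move=> FU nr ap ah.
have /choice[ev hev] (q : xtype phi M) : exists g : ytype phi M -> R,
    [/\ forall c, xtp phi c = q -> forall b, g b = yvalue b c,
        q = p -> g = h &
        exists F : set_system M, [/\ ProperFilter F, xtp phi @ F --> q &
          forall b : ytype phi M, yvalue b c @[c --> F] --> g b]].
  have [->|qp] := eqVneq q p.
    exists h; split=> // [c /nr //|].
    by exists (a @ U); split=> //; exact: fmap_proper_filter.
  have [[c cq]|nc] := pselect (exists c, xtp phi c = q).
    exists (fun b => yvalue b c); split.
    - by move=> c' c'q b; apply: xtp_yvalue; rewrite cq c'q.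
    - by move=> /eqP; rewrite (negbTE qp).
    exists (principal_filter c); split.
    - exact: principal_filter_proper.
    - by rewrite -cq => A /nbhs_singleton Ac; apply/principal_filterP.
    - by move=> b A /nbhs_singleton Ac; apply/principal_filterP.
  have [V [VV Vq]] := xtype_net q.
  have /choice[g hg] (b : ytype phi M) : exists l, yvalue b c @[c --> V] --> (l : R).
    have [|l _ ?] := @ultra_cvg_bounded R M V (yvalue b) (bound phi) VV.
      by move=> c; exact: yvalue_bound.
    by exists l.
  exists g; split.
  - by move=> c cq; case: nc; exists c.
  - by move=> /eqP; rewrite (negbTE qp).
  - by exists V; split=> //; exact: ultra_proper.
exists ev; last by have [_ + _] := hev p; apply.
split=> [c b|q]; first by have [+ _ _] := hev (xtp phi c); apply.
by have [_ _] := hev q.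
Qed.

End Evaluations.

Section CompletedRadon.
Variables (R : realType) (S : ptopologicalType) (mu : probability (Borel S) R).
Hypothesis radon : is_radon mu.

(** A countable Borel cover of the complement of [Y] has total mass below 1. The complement of its
    union is a Borel subset of [Y] of positive measure, to which the Radon property applies. *)
Lemma completed_inner_compact (Y : set S) :
  measurable (Y : set (completed_type mu)) -> 0 < om mu Y ->
  exists C : set S, [/\ compact C, C `<=` Y & (0 < mu C)%E].
Proof.
move=> mY Y0.
have Yc : om mu (~` Y) < 1.
  have := mY setT; rewrite !setTI /= !omE.
  have -> : om mu setT = 1.
    by apply: EFin_inj; rewrite om_measurable ?probability_setT.
  by rewrite -EFinD => -[]; lra.
have : ((mu^*)%mu (~` Y : set (Borel S)) < 1%:E)%E by rewrite omE lte_fin.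
rewrite /mu_ext => /ereal_inf_lt[_ [F [mF FY] <-] F1].
pose B : set (Borel S) := \bigcup_k F k.
have mB : measurable B by exact: bigcupT_measurable.
have B1 : (mu B < 1%:E)%E.
  by apply: le_lt_trans F1; apply: measure_sigma_subadditive.
have mBc : measurable (~` B) by exact: measurableC.
have Bc : (0 < mu (~` B))%E.
  by rewrite probability_setC// sube_gt0.
move: Bc; rewrite radon// => /ereal_sup_gt[_ [C [cC CB] <-] C0].
exists C; split=> // x /CB nBx; apply: contrapT => /FY Bx.
exact: nBx.
Qed.

End CompletedRadon.

(** * Nonmeasurability of the limit of an independent sequence *)

Section NonmeasurableLimit.
Variables (R : realType) (L : signature R) (phi : formula L 2) (M : structure L).
Variables (al be : R) (a : nat -> M).
Hypothesis albe : al < be.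
Hypothesis inda : independent_sequence phi al be a.
Variables (U : set_system nat) (UU : UltraFilter U).
Hypothesis Ucof : \oo `<=` U.

Definition level_set (i : nat) (t : bool) : set (ytype phi M) :=
  if t then [set q | be <= yvalue q (a i)] else [set q | yvalue q (a i) <= al].

Lemma level_set_closed i t : closed (level_set i t).
Proof.
case: t; rewrite /level_set.
- apply: (@closed_comp _ _ (fun q : ytype phi M => yvalue q (a i)) [set x | be <= x]).
    by move=> q _; exact: yvalue_continuous.
  exact: closed_ge.
- apply: (@closed_comp _ _ (fun q : ytype phi M => yvalue q (a i)) [set x | x <= al]).
    by move=> q _; exact: yvalue_continuous.
  exact: closed_le.
Qed.

Lemma level_set_disj i : level_set i true `&` level_set i false = set0.
Proof.
apply/seteqP; split=> // q [/= h1 h2].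
by have := lt_le_trans albe (le_trans h1 h2); rewrite ltxx.
Qed.

Lemma independent_not_almost_definable : exists2 mu : probability (Borel (ytype phi M)) R,
  is_radon mu & forall (ev : xtype phi M -> ytype phi M -> R) p,
    (forall b, yvalue b (a i) @[i --> U] --> ev p b) -> ~ almost_definable mu ev p.
Proof.
have /choice[pt hpt] (s : seq bool) : exists b : M, forall i,
    if nth false s i then be <= value phi (a i) b else value phi (a i) b <= al.
  exact: inda.
have ptZ s i : level_set i (nth false s i) (ytp phi (pt s)).
  by have := hpt s i; case: (nth false s i).
have [mu radon [mu1 mucyl]] := @coin_flip_measure R (ytype phi M)
  (@ytype_hausdorff R L phi M) (@ytype_compact R L phi M) level_set
  level_set_closed level_set_disj _ ptZ.
exists mu => // ev p evp [psi [mpsi _] [mA A1]].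
set A := [set b | ev p b = psi b] in mA A1.
pose K0 := cylinders level_set.
have cK0 : closed K0 by exact: cylinders_closed level_set_closed.
pose T := completed_type mu.
have mK0 : measurable (K0 : set T) by apply: borel_completed; exact: closed_borel.
have mge : measurable ([set b | be <= psi b] : set T).
  have := mpsi measurableT [set` `[be, +oo[] (measurable_itv _).
  by rewrite setTI; congr measurable; apply/seteqP; split=> b /=; rewrite in_itv/= andbT.
(* Up to a null set the space is the union of the two pieces, so one of them has positive measure;
   on each piece [ev p] stays on one side of the gap. *)
pose Y1 := A `&` K0 `&` [set b | be <= psi b].
pose Y2 := A `&` K0 `&` ~` [set b | be <= psi b].
have mY1 : measurable (Y1 : set T) by apply: measurableI => //; exact: measurableI.
have mY2 : measurable (Y2 : set T).
  by apply: measurableI; [exact: measurableI|exact: measurableC].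
have AK : om mu (A `&` K0) = 1.
  have oA : om mu (~` A) = 0.
    have := mA setT; rewrite !setTI /= !omE => -[].
    have -> : om mu setT = 1.
      by apply: EFin_inj; rewrite om_measurable ?probability_setT.
    have -> : om mu A = 1 by apply: EFin_inj; rewrite -completion_omE.
    by lra.
  have oK : om mu (~` K0) = 0.
    have mK := closed_borel cK0; apply: EFin_inj; rewrite om_measurable; last exact: measurableC.
    by rewrite probability_setC// mu1 subee.
  have h1 : om mu setT = 1.
    by apply: EFin_inj; rewrite om_measurable ?probability_setT.
  have h2 : om mu setT <= om mu ((A `&` K0) `|` (~` A `|` ~` K0)).
    by apply: om_mono => x _; rewrite -setCI setUv.
  have h3 := omU mu (A `&` K0) (~` A `|` ~` K0).
  have h4 := omU mu (~` A) (~` K0).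
  have h5 : om mu (A `&` K0) <= om mu setT by exact: om_mono.
  by lra.
have Y12 : 0 < om mu Y1 \/ 0 < om mu Y2.
  have : om mu (A `&` K0) <= om mu (Y1 `|` Y2).
    by apply: om_mono => x Ax; have [?|?] := pselect (be <= psi x); [left|right].
  have := omU mu Y1 Y2; have := om_ge0 mu Y1; have := om_ge0 mu Y2.
  by have [|] := ltP 0 (om mu Y1); [left|right; lra].
have near_gt x : be <= ev p x -> \forall i \near U, al < yvalue x (a i).
  by move=> h; apply: (cvgr_gt _ (evp x)); exact: lt_le_trans h.
have near_lt x : ev p x <= al -> \forall i \near U, yvalue x (a i) < be.
  by move=> h; apply: (cvgr_lt _ (evp x)); exact: le_lt_trans albe.
(* On [K0] every [yvalue x (a i)] avoids the open interval from [al] to [be], hence so does their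
   limit. *)
have dich x : K0 x -> ev p x < be -> ev p x <= al.
  move=> Kx lt_be.
  have h : \forall i \near U, yvalue x (a i) < be by exact: (cvgr_lt _ (evp x) _ lt_be).
  apply: (cvgr_to_le (evp x)); apply: filterS h => i.
  by have [[] /=] := Kx i; lra.
have opp Y : measurable (Y : set T) -> 0 < om mu Y ->
    exists m x x', [/\ Y x, Y x' & forall i, (m <= i)%N ->
      exists t, level_set i t x /\ level_set i (~~ t) x'].
  move=> mY Y0.
  have [C [cC CY C0]] := completed_inner_compact radon mY Y0.
  have clC : closed C by apply: compact_closed => //; exact: ytype_hausdorff.
  have [m [x [x' [Cx Cx' hx]]]] := opposite_points (@ytype_compact R L phi M)
    level_set_closed mu1 mucyl clC C0.
  by exists m, x, x'; split=> //; exact: CY.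
(* In either piece, [x] and [x'] have limits on the same side of the gap, although their values are
   on opposite sides at every [i >= m]. *)
case: Y12 => [/(opp _ mY1)|/(opp _ mY2)] [m [x [x' [Yx Yx' hx]]]].
- have [[[Ax _] bx] [[Ax' _] bx']] := (Yx, Yx').
  have near_m : \forall i \near U, (m <= i)%N by apply: Ucof; exists m.
  have h1 : be <= ev p x by rewrite Ax.
  have h2 : be <= ev p x' by rewrite Ax'.
  have [i [[g1 g2] g3]] := filter_ex (filterI (filterI (near_gt _ h1) (near_gt _ h2)) near_m).
  by have [[] /= []] := hx i g3; lra.
- have [[[Ax Kx] /negP bx] [[Ax' Kx'] /negP bx']] := (Yx, Yx').
  have near_m : \forall i \near U, (m <= i)%N by apply: Ucof; exists m.
  have h1 : ev p x <= al by apply: dich => //; rewrite Ax ltNge.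
  have h2 : ev p x' <= al by apply: dich => //; rewrite Ax' ltNge.
  have [i [[g1 g2] g3]] := filter_ex (filterI (filterI (near_lt _ h1) (near_lt _ h2)) near_m).
  by have [[] /= []] := hx i g3; lra.
Qed.

End NonmeasurableLimit.

Theorem mainTheorem5 (R : realType) (L : signature R) (T : theory L)
    (phi : formula L 2) :
  NIP phi T <->
  (forall M : structure L, models M T ->
   forall mu : probability (Borel (ytype phi M)) R, is_radon mu ->
   forall ev : xtype phi M -> ytype phi M -> R, evaluation ev ->
     (forall p : xtype phi M, almost_definable mu ev p) /\
     (forall psi : xtype phi M -> ytype phi M -> R,
        defining_relations mu ev psi ->
        density_le (@class_dist R L phi M mu psi) (@mdist R M))).
Proof.
split=> [nip M MT mu radon ev ev_eval|def M MT].
  split=> [p|psi hpsi].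
    exact: nip_almost_definable (nip M MT) _ radon _ ev_eval p.
  exact: nip_density (nip M MT) _ radon _ ev_eval _ hpsi.
apply: (@dependent_subsequentially_cvg R M (ytype phi M)
  (fun a q => yvalue q a) (bound phi)) => [a q|al be albe].
  exact: yvalue_bound.
apply: contrapT => dep.
have indep k : independent_of_length (fun a (b : M) => value phi a b) al be k.
  by apply: realized_independent; apply: contrapT => nk; apply: dep; exists k.
have [U [UU Ucof]] := @ultraFilterLemma nat \oo _.
have [a inda] := ultrapower_independent UU Ucof indep.
set M1 := ultrapower M UU in a inda *.
pose M2 := ultrapower M1 UU.
pose a2 i : M2 := diag UU (a i).
have inda2 : independent_sequence phi al be a2.
  move=> s; have [b hb] := inda s; exists (diag UU b) => i.
  have -> : value phi (a2 i) (diag UU b) = value phi (a i) b; last exact: hb.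
  apply: (cvg_unique (@Rhausdorff R) (@value_ultrapower R L M1 nat U UU phi (fun=> a i) (fun=> b))).
  exact: cvg_cst.
have M2T : models M2 T by apply: models_ultrapower; exact: models_ultrapower.
have [mu radon nodef] := independent_not_almost_definable albe inda2 UU Ucof.
have /choice[q hq] (b : M2) : exists l, value phi (a2 i) b @[i --> U] --> (l : R).
  have [|l _ ?] := @ultra_cvg_bounded R nat U (fun i => value phi (a2 i) b) (bound phi) UU.
    by move=> i; exact: eval_bound.
  by exists l.
have /choice[h hh] (b : ytype phi M2) : exists l, yvalue b (a2 i) @[i --> U] --> (l : R).
  have [|l _ ?] := @ultra_cvg_bounded R nat U (fun i => yvalue b (a2 i)) (bound phi) UU.
    by move=> i; exact: yvalue_bound.
  by exists l.
pose p : xtype phi M2 := mk_type (@limit_complete_type R L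
  (fun N c b => value phi c b) phi (fun _ _ _ => erefl) M2 nat U a2 q UU hq).
have [|||ev ev_eval evp] := @evaluation_along R L phi M2 p nat U a2 h (@ultra_proper _ _ UU).
- move=> c cp; apply: (limit_not_realized Ucof albe inda (c := c)) => b.
  have <- : q b = value phi c b by rewrite -[RHS]/(type_value (xtp phi c) b) cp.
  exact: hq.
- apply/cvg_type_space => b; exact: hq.
- exact: hh.
have [+ _] := def M2 M2T mu radon ev ev_eval.
by move=> /(_ p); apply: nodef => b; rewrite evp; exact: hh.
Qed.
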